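(* Let $n\ge 2$, let $H$ be an oriented $(n-1)$-dimensional linear subspace of $\mathbb{R}^n$, let $X=\mathcal{M}(\mathbb{R}^n)$ (or $X=\mathcal{M}_+(\mathbb{R}^n)$, $\mathcal{S}(\mathbb{R}^n)$, or $\mathcal{V}(\mathbb{R}^n)$), and suppose that $T:X\to X$ is pointwise with respect to $H$, with associated functions $F^+,F^-:D^2\to D$, and equimeasurable. The following statements are equivalent. (i) The associated functions $F^+$ and $F^-$ are continuous on $D^2$. (ii) $T$ is monotonic. (iii) $T$ is a rearrangement. (iv) If $X=\mathcal{M}(\mathbb{R}^n)$: $T$ maps linear functions to continuous functions. (If $X=\mathcal{M}_+(\mathbb{R}^n)$, $\mathcal{S}(\mathbb{R}^n)$, or $\mathcal{V}(\mathbb{R}^n)$: $T$ maps piecewise linear continuous functions in $X$ to continuous functions.) (v) $T$ is $L^p$-contracting for some (or, equivalently, for all) $1\le p\le\infty$. (vi) $T$ reduces the modulus of continuity. (vii) $T=\mathrm{Id}$, $T=\dagger$, $T=P_H$, or $T=P_H^\dagger$.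
   Context: $\mathcal{H}^n$ is $n$-dimensional Hausdorff (Lebesgue) measure on $\mathbb{R}^n$; ''essentially'' means up to a set of $\mathcal{H}^n$-measure zero. $\mathcal{M}(\mathbb{R}^n)$ (respectively $\mathcal{M}_+(\mathbb{R}^n)$) is the set of real-valued (respectively nonnegative real-valued) $\mathcal{H}^n$-measurable functions on $\mathbb{R}^n$. $\mathcal{S}(\mathbb{R}^n)$ is the set of $f\in\mathcal{M}(\mathbb{R}^n)$ with $\mathcal{H}^n(\{x:f(x)>t\})<\infty$ for all real $t>\operatorname{ess\,inf} f$ (where $\operatorname{ess\,inf} f=-\infty$ is allowed). $\mathcal{V}(\mathbb{R}^n)$ is the set of $f\in\mathcal{M}_+(\mathbb{R}^n)$ with $\mathcal{H}^n(\{x:f(x)>t\})<\infty$ for all $t>0$. The orientation of $H$ determines the two closed half-spaces $H^+$ and $H^-$ bounded by $H$. For $x\in\mathbb{R}^n$, $x^\dagger$ is the reflection of $x$ in $H$, and $f^\dagger(x)=f(x^\dagger)$. $D=\{f(x):x\in\mathbb{R}^n,\ f\in X\}$; thus $D=\mathbb{R}$ if $X=\mathcal{M}(\mathbb{R}^n)$ or $\mathcal{S}(\mathbb{R}^n)$, and $D=[0,\infty)$ if $X=\mathcal{M}_+(\mathbb{R}^n)$ or $\mathcal{V}(\mathbb{R}^n)$. A map $T:X\to X$ is pointwise with respect to $H$ if there are functions $F^+,F^-:D^2\to D$ (the functions associated with $T$) that coincide on the diagonal $\{(s,s):s\in D\}$, such that for all $f\in X$, $Tf(x)=F^+(f(x),f^\dagger(x))$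 if $x\in H^+$ and $Tf(x)=F^-(f(x),f^\dagger(x))$ if $x\in H^-$. Properties of $T:X\to X$ (for all $f,g\in X$): equimeasurable: $\mathcal{H}^n(\{x:Tf(x)>t\})=\mathcal{H}^n(\{x:f(x)>t\})$ for all $t\in\mathbb{R}$; monotonic: $f\le g$ essentially implies $Tf\le Tg$ essentially; rearrangement: equimeasurable and monotonic; $L^p$-contracting: $\|Tf-Tg\|_p\le\|f-g\|_p$ whenever $f-g\in L^p(\mathbb{R}^n)$; reduces the modulus of continuity: $\omega_d(Tf)\le\omega_d(f)$ for all $d>0$, where $\omega_d(f)=\operatorname{ess\,sup}_{\|x-y\|\le d}|f(x)-f(y)|$. $\mathrm{Id}$ is the identity map; $\dagger$ is the map $f\mapsto f^\dagger$; $P_H$ (polarization) is given by $P_Hf(x)=\max\{f(x),f(x^\dagger)\}$ if $x\in H^+$ and $P_Hf(x)=\min\{f(x),f(x^\dagger)\}$ if $x\in H^-$; and $P_H^\dagger=\dagger\circ P_H$, i.e. $P_H^\dagger f=(P_Hf)^\dagger$. *)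

(* Defs.v *)
From HB Require Import structures.
From mathcomp Require Import all_boot all_order all_algebra.
From mathcomp Require Import all_classical all_reals all_analysis.
From mathcomp Require Import ess_sup_inf hoelder lra.

Set Implicit Arguments.
Unset Strict Implicit.
Unset Printing Implicit Defensive.

Import Order.TTheory GRing.Theory Num.Theory.
Import numFieldNormedType.Exports.

Local Open Scope classical_set_scope.
Local Open Scope ring_scope.

Section lebesgue_outer.
Context (R : realType) (n : nat).
Implicit Types (a b : 'rV[R]_n) (X : set 'rV[R]_n).

Definition box a b : set 'rV[R]_n :=
  [set x | forall i, a ord0 i < x ord0 i <= b ord0 i].

(* The truncation makes an empty box count 0. *)
Definition box_vol a b : R := \prod_(i < n) Num.max 0 (b ord0 i - a ord0 i).

(* The boxes of a cover are indexed by the k : nat with P k, so that finite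
   (possibly empty) covers are allowed and the definition is right at n = 0. *)
Definition box_cover X (P : pred nat) (A : nat -> 'rV[R]_n * 'rV[R]_n) :=
  X `<=` \bigcup_(k in [set k | P k]) box (A k).1 (A k).2.

Definition leb_outer X : \bar R :=
  ereal_inf [set c | exists P A, box_cover X P A /\
    c = (\sum_(k <oo | P k) (box_vol (A k).1 (A k).2)%:E)%E].

Lemma box_vol_ge0 a b : 0 <= box_vol a b.
Proof. by apply: prodr_ge0 => i _; rewrite le_max lexx. Qed.

Local Open Scope ereal_scope.

Let boxE_ge0 (A : nat -> 'rV[R]_n * 'rV[R]_n) k :
  0 <= (box_vol (A k).1 (A k).2)%:E.
Proof. by rewrite lee_fin box_vol_ge0. Qed.

Lemma leb_outer_ge0 X : 0 <= leb_outer X.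
Proof.
apply: le_ereal_inf_tmp => _ [P [A [_ ->]]].
by apply: nneseries_ge0 => k _ _; exact: boxE_ge0.
Qed.

Lemma leb_outer_set0 : leb_outer set0 = 0.
Proof.
apply/eqP; rewrite eq_le leb_outer_ge0 andbT.
apply: ereal_inf_lbound; exists xpred0, (fun=> (0%R, 0%R)); split => //.
by rewrite eseries_pred0.
Qed.

Lemma leb_outer_homo : {homo leb_outer : X Y / X `<=` Y >-> X <= Y}.
Proof.
move=> X Y XY; apply/ereal_inf_le_tmp => _ [P [A [YA ->]]].
by exists P, A; split => //; exact: subset_trans YA.
Qed.

Lemma leb_outer_sigma_subadditive : sigma_subadditive leb_outer.
Proof.
move=> X; have [[i ioo]|] := pselect (exists i, leb_outer (X i) = +oo).
  rewrite (eseries_pinfty _ _ ioo) ?leey// => k _.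
  by rewrite -ltNye (lt_le_trans _ (leb_outer_ge0 _)).
rewrite -forallNE => Xoo; apply/lee_addgt0Pr => e e0.
rewrite (le_trans _ (epsilon_trick _ _ (ltW e0)))//; last first.
  by move=> k; exact: leb_outer_ge0.
have near_inf m : exists PA : pred nat * (nat -> 'rV[R]_n * 'rV[R]_n),
    box_cover (X m) PA.1 PA.2 /\
    \sum_(k <oo | PA.1 k) (box_vol (PA.2 k).1 (PA.2 k).2)%:E
      <= leb_outer (X m) + (e / (2 ^ m.+1)%:R)%:E.
  have em0 : (0 < e / (2 ^ m.+1)%:R)%R by rewrite divr_gt0// ltr0n expn_gt0.
  have fX : leb_outer (X m) \is a fin_num.
    by rewrite ge0_fin_numE ?leb_outer_ge0// ltey; apply/eqP/Xoo.
  have [_ [P [A [XA ->]]] lt] := lb_ereal_inf_adherent em0 fX.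
  by exists (P, A); split => //; exact: ltW.
have {near_inf}[G /all_and2[coverG leG]] := choice near_inf.
pose Q (p : nat * nat) := (G p.1).1 p.2.
pose V (p : nat * nat) := (G p.1).2 p.2.
pose g p := if Q p then (box_vol (V p).1 (V p).2)%:E else 0.
have g0 p : 0 <= g p by rewrite /g; case: ifP => // _; rewrite lee_fin box_vol_ge0.
apply: (@le_trans _ _ (\esum_(p in setT) g p)).
  apply: ereal_inf_lbound => /=.
  have /card_esym/ppcard_eqP[f] := card_nat2.
  exists (Q \o f), (V \o f); split.
    move=> x [m _ /coverG[k Qk xk]]; exists (f^-1%FUN (m, k)) => /=;
      by rewrite invK ?inE.
  rewrite [RHS]eseries_mkcond.
  rewrite -(esum_pred_image g f xpredT)//; last first.
    by move=> a b _ _ ab; apply: (@inj _ _ _ f); rewrite ?inE.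
  by congr esum; apply/seteqP; split => // p _; exists (f^-1%FUN p);
    rewrite ?invK ?inE.
have esumE : \esum_(p in [set: nat * nat]) g p =
    \sum_(i <oo) \sum_(j <oo) g (i, j).
  pose J : nat -> set (nat * nat) := fun i => [set (i, j) | j in setT].
  rewrite (_ : setT = \bigcup_k J k); last first.
    by rewrite predeqE => -[a b]; split => // _; exists a => //; exists b.
  rewrite esum_bigcupT /=; last 2 first.
    - apply/trivIsetP => i j _ _ ij.
      rewrite predeqE => -[k m] /=; split => //= -[] [_] _ [<-{k} _].
      by move=> [m' _] [] /esym/eqP; rewrite (negbTE ij).
    - by [].
  rewrite -(image_id [set: nat]) -fun_true esum_pred_image//; last first.
    by move=> k _; exact: esum_ge0.
  apply: eq_eseriesr => /= j _.
  rewrite -(esum_pred_image g (pair j) predT)//=; last first.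
    by move=> ? ? _ _; exact: (@can_inj _ _ _ snd).
  by congr esum; rewrite predeqE => -[a b]; split; move=> [i _ <-]; exists i.
rewrite esumE; apply: lee_nneseries => [i _ _|i _]; first exact: nneseries_ge0.
by rewrite (le_trans _ (leG i))// [leRHS]eseries_mkcond.
Qed.

HB.instance Definition _ := isOuterMeasure.Build R 'rV[R]_n leb_outer
  leb_outer_set0 leb_outer_ge0 leb_outer_homo leb_outer_sigma_subadditive.

End lebesgue_outer.

(* R^n with the sigma-algebra of Lebesgue measurable sets (Caratheodory's
   criterion), which contains all subsets of null sets. *)
Definition lebRn (R : realType) (n : nat) : Type :=
  caratheodory_type (@leb_outer R n).

HB.instance Definition _ (R : realType) (n : nat) :=
  Measurable.copy (lebRn R n)
    (caratheodory_type (@leb_outer R n : {outer_measure set _ -> \bar R})).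

Definition leb (R : realType) (n : nat) : set (lebRn R n) -> \bar R :=
  @leb_outer R n.
Arguments leb {R n}.

Section leb_measure.
Context (R : realType) (n : nat).

Let leb_semi_sigma_additive : semi_sigma_additive (@leb R n).
Proof. exact: (@caratheodory_measure_sigma_additive _ _ (@leb_outer R n)). Qed.

HB.instance Definition _ := isMeasure.Build _ _ _ (@leb R n)
  (@leb_outer_set0 R n) (@leb_outer_ge0 R n) leb_semi_sigma_additive.

End leb_measure.

Section leb_sigma_finite.
Context (R : realType) (n : nat).
Implicit Types (a b : 'rV[R]_n) (X : set 'rV[R]_n).

Local Open Scope ereal_scope.

Lemma leb_outer_box a b : leb_outer (box a b) <= (box_vol a b)%:E.
Proof.
apply: ereal_inf_lbound; exists (pred1 0%N), (fun=> (a, b)); split.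
  by move=> x xab; exists 0%N => //=.
rewrite eseries_mkcond (@nneseries_split _ _ 0%N 1%N)//=; last first.
  by move=> k _; case: ifP => // _; rewrite lee_fin box_vol_ge0.
rewrite add0n big_nat1/= eseries0 ?adde0//.
by move=> [].
Qed.

Lemma measurable_half_space (i : 'I_n) (c : R) :
  measurable ([set x : 'rV[R]_n | (x ord0 i <= c)%R] : set (lebRn R n)).
Proof.
apply: le_caratheodory_measurable => X.
set S := [set x | _].
apply: le_ereal_inf_tmp => _ [P [A [XA ->]]].
pose lo b : 'rV[R]_n :=
  \row_j (if j == i then Num.min (b ord0 j) c else b ord0 j).
pose hi a : 'rV[R]_n :=
  \row_j (if j == i then Num.max (a ord0 j) c else a ord0 j).
have vol_split a b : box_vol a b = (box_vol a (lo b) + box_vol (hi a) b)%R.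
  rewrite /box_vol (bigD1 i)//= [in RHS](bigD1 i)//=.
  rewrite [X in (_ = _ + X)%R](bigD1 i)//= !mxE eqxx.
  under [in X in (_ = X + _)%R]eq_bigr => j ji do rewrite mxE (negbTE ji).
  under [in X in (_ = _ + X)%R]eq_bigr => j ji do rewrite mxE (negbTE ji).
  rewrite -mulrDl; congr (_ * _)%R.
  rewrite /Num.max /Num.min.
  by repeat case: ifPn; rewrite -?leNgt => *; lra.
rewrite (eq_eseriesr (fun k _ => congr1 EFin (vol_split (A k).1 (A k).2))).
under eq_eseriesr do rewrite EFinD.
rewrite nneseriesD; last 2 first.
- by move=> k _ _; rewrite lee_fin box_vol_ge0.
- by move=> k _ _; rewrite lee_fin box_vol_ge0.
apply: leeD; apply: ereal_inf_lbound.
- exists P, (fun k => ((A k).1, lo (A k).2)); split => //.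
  move=> x [/XA[k Pk xk] xc]; exists k => // j /=; have /andP[aj bj] := xk j.
  rewrite aj mxE; case: eqP => [->|//]; rewrite /= le_min.
  by have /andP[_ ->] := xk i; exact: xc.
- exists P, (fun k => (hi (A k).1, (A k).2)); split => //.
  move=> x [/XA[k Pk xk] /negP xc]; exists k => // j /=.
  have /andP[aj bj] := xk j.
  rewrite bj andbT mxE; case: eqP => [->|//]; rewrite gt_max.
  by have /andP[-> _] := xk i; rewrite ltNge.
Qed.

Lemma measurable_box a b : measurable (box a b : set (lebRn R n)).
Proof.
rewrite (_ : box a b = \bigcap_(i in [set: 'I_n])
  ([set x : 'rV[R]_n | (x ord0 i <= b ord0 i)%R] `\`
   [set x : 'rV[R]_n | (x ord0 i <= a ord0 i)%R])); last first.
  apply/seteqP; split => x xab i.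
    by move=> _; have /andP[ai bi] := xab i; split => //=; apply/negP; rewrite -ltNge.
  by have [/= -> /negP] := xab i Logic.I; rewrite -ltNge => ->.
by apply: fin_bigcap_measurable => // i _; apply: measurableD;
  exact: measurable_half_space.
Qed.

Lemma sigma_finite_leb : sigma_finite setT (@leb R n).
Proof.
pose r k : 'rV[R]_n := const_mx k%:R.
exists (fun k => box (- r k)%R (r k)) => [|k].
  apply/seteqP; split => // x _.
  pose M : R := (\sum_i `|x ord0 i|)%R.
  exists (Num.truncn M).+1 => // i; rewrite !mxE.
  have xM : (`|x ord0 i| <= M)%R.
    by rewrite /M (bigD1 i)//= lerDl sumr_ge0.
  have /(le_lt_trans xM) := truncnS_gt M.
  by rewrite ltr_norml => /andP[-> /ltW].
split; first exact: measurable_box.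
by rewrite (le_lt_trans (leb_outer_box _ _))// ltry.
Qed.

End leb_sigma_finite.

HB.instance Definition _ (R : realType) (n : nat) :=
  Measure_isSigmaFinite.Build _ _ _ (@leb R n) (@sigma_finite_leb R n).

Section euclidean.
Context (R : realType) (n : nat).
Implicit Types (x y u v : 'rV[R]_n) (f : 'rV[R]_n -> R).

Definition dot x y : R := \sum_(i < n) x ord0 i * y ord0 i.

(* The norm `|x| of the library is the sup norm on row vectors. *)
Definition enorm x : R := Num.sqrt (dot x x).

(* An oriented hyperplane H is given with its unit normal vector u pointing
   into H^+. *)
Definition oriented_hyperplane (H : {vspace 'rV[R]_n}) u :=
  [/\ \dim H = n.-1, enorm u = 1 & forall x, x \in H -> dot x u = 0].

Definition pos_half_space u : set 'rV[R]_n := [set x | 0 <= dot x u].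
Definition neg_half_space u : set 'rV[R]_n := [set x | dot x u <= 0].

Definition reflection u x : 'rV[R]_n := x - (2 * dot x u) *: u.

Definition dagger u f : 'rV[R]_n -> R := fun x => f (reflection u x).

Definition polarization u f : 'rV[R]_n -> R := fun x =>
  if 0 <= dot x u then Num.max (f x) (f (reflection u x))
  else Num.min (f x) (f (reflection u x)).

Definition closed_polyhedron (P : set 'rV[R]_n) :=
  exists m (v : 'I_m -> 'rV[R]_n) (b : 'I_m -> R),
    P = [set x | forall i, dot x (v i) <= b i].

Definition piecewise_linear f :=
  exists k (P : 'I_k -> set 'rV[R]_n) (v : 'I_k -> 'rV[R]_n) (c : 'I_k -> R),
    [/\ forall i, closed_polyhedron (P i),
        forall x, exists i, P i x &
        forall i x, P i x -> f x = dot x (v i) + c i].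

End euclidean.

Section function_spaces.
Context (R : realType) (n : nat).
Implicit Types (f g : 'rV[R]_n -> R).

Local Open Scope ereal_scope.

Definition superlevel f (t : R) : set (lebRn R n) := [set x | (t < f x)%R].

Definition measurable_functions : set ('rV[R]_n -> R) :=
  [set f | measurable_fun setT (f : lebRn R n -> R)].

Definition nonneg_measurable_functions : set ('rV[R]_n -> R) :=
  [set f | measurable_functions f /\ forall x, (0 <= f x)%R].

Definition S_functions : set ('rV[R]_n -> R) :=
  [set f | measurable_functions f /\
    forall t : R, ess_inf (@leb R n) (EFin \o f) < t%:E ->
      leb (superlevel f t) < +oo].

Definition V_functions : set ('rV[R]_n -> R) :=
  [set f | nonneg_measurable_functions f /\
    forall t : R, (0 < t)%R -> leb (superlevel f t) < +oo].

End function_spaces.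

Inductive space_kind := KindM | KindMplus | KindS | KindV.

Definition function_space (R : realType) (n : nat) (k : space_kind) :
    set ('rV[R]_n -> R) :=
  match k with
  | KindM => @measurable_functions R n
  | KindMplus => @nonneg_measurable_functions R n
  | KindS => @S_functions R n
  | KindV => @V_functions R n
  end.

(* Only M(R^n) contains the nonzero linear functions; in the other spaces they
   are replaced by continuous piecewise linear (piecewise affine) functions. *)
Definition test_function (R : realType) (n : nat) (k : space_kind)
    (f : 'rV[R]_n -> R) : Prop :=
  match k with
  | KindM => scalar f
  | _ => [/\ function_space k f, piecewise_linear f & continuous f]
  end.

Section maps.
Context (R : realType) (n : nat).
Variable X : set ('rV[R]_n -> R).
Implicit Types (T : ('rV[R]_n -> R) -> 'rV[R]_n -> R) (u : 'rV[R]_n).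
Implicit Types (f g : 'rV[R]_n -> R) (F : R * R -> R) (p : \bar R).

Definition value_set : set R := [set f x | f in X & x in setT].

Definition pointwise_map u T Fplus Fminus :=
  [/\ forall s r, value_set s -> value_set r ->
        value_set (Fplus (s, r)) /\ value_set (Fminus (s, r)),
      forall s, value_set s -> Fplus (s, s) = Fminus (s, s) &
      forall f, X f -> forall x,
        (pos_half_space u x -> T f x = Fplus (f x, dagger u f x)) /\
        (neg_half_space u x -> T f x = Fminus (f x, dagger u f x))].

Definition equimeasurable T := forall f, X f -> forall t : R,
  leb (superlevel (T f) t) = leb (superlevel f t).

Definition monotonic T := forall f g, X f -> X g ->
  (\forall x \ae (@leb R n), f x <= g x) ->
  (\forall x \ae (@leb R n), T f x <= T g x).

Definition rearrangement T := equimeasurable T /\ monotonic T.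

Definition Lp_contracting p T := forall f g, X f -> X g ->
  (f \- g : lebRn R n -> R) \in Lfun (@leb R n) p ->
  ('N[@leb R n]_p[EFin \o (T f \- T g)%R]
    <= 'N[@leb R n]_p[EFin \o (f \- g)%R])%E.

(* The essential supremum, for the product measure, over the set of pairs
   at Euclidean distance at most d. *)
Definition modulus_of_continuity (d : R) f : \bar R :=
  ereal_inf [set c : \bar R |
    \forall z \ae ((@leb R n) \x (@leb R n))%E,
      enorm ((z.1 : 'rV[R]_n) - z.2) <= d -> (`|f z.1 - f z.2|%:E <= c)%E].

Definition reduces_modulus_of_continuity T := forall f, X f ->
  forall d : R, 0 < d ->
    (modulus_of_continuity d (T f) <= modulus_of_continuity d f)%E.

End maps.

(* Main.v *)
Require Import Defs.
From mathcomp Require Import all_boot all_order all_algebra.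
From mathcomp Require Import all_classical all_reals all_analysis.
From mathcomp Require Import measurable_realfun ess_sup_inf ring lra.

(** Equimeasurability, tested on functions with two values s and t off a base value,
   one on a ball and the other on its mirror image, shows that F+(s, t) and F-(t, s)
   are s and t in some order (pair_choice). So T decides, for every pair of distinct
   values, whether to keep it or to swap it, and the four maps are those for which
   the decision is the same on each side of the diagonal
   (four_maps_of_constant_choice).

   Each of the other properties forces such a uniform decision. If F+ is continuous,
   or T f is continuous for enough test functions f, or T contracts an Lp norm, or T
   reduces the modulus of continuity, then nearby pairs get the same decision:
   otherwise two nearby functions would have images that are far apart, or a slowly
   varying function would have an image that jumps. A locally constant decision is
   constant along every segment that avoids the diagonal
   (constant_choice_of_local). If T is monotonic, the decision at a pair propagates
   to all pairs with a wider gap around it, hence is uniform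
   (monotonic_constant_choice).

   Conversely, the four maps are monotonic and preserve continuity. Polarization
   contracts Lp norms because pairing two pairs of numbers monotonically lowers the
   sum of the p-th powers of the distances (powR_dist_rearrangement), which is
   integrated after averaging over the reflection (Lnorm_le_of_paired). It reduces
   the modulus of continuity because the mirror image of a point is nearer to the
   points of the opposite side (polarization_dist).

   The converse uses that the reflection preserves Lebesgue measure. This is read off
   from T: unless T is the identity, it carries sets to their mirror images, and it
   is equimeasurable (identity_or_reflection_invariant). *)

Import Order.TTheory GRing.Theory Num.Theory.
Import numFieldNormedType.Exports.

Set Implicit Arguments.
Unset Strict Implicit.
Unset Printing Implicit Defensive.

Local Open Scope classical_set_scope.
Local Open Scope ring_scope.

(** * Volume of boxes *)

Lemma integral_scaled_itv (R : realType) (c a b : R) : 0 <= c ->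
  (\int[lebesgue_measure]_t (c * \1_`]a, b] t)%:E = (c * Num.max 0 (b - a))%:E)%E.
Proof.
move=> c0.
under eq_integral do rewrite EFinM.
rewrite ge0_integralZl//=; last first.
  by apply/measurable_EFinP; exact: measurable_indic.
rewrite integral_indic// setIT.
rewrite [X in (_ * X)%E](lebesgue_measure_itv `]a, b])/= EFinM.
congr (_ * _)%E; rewrite lte_fin; case: ltP => ab.
  by rewrite -EFinD max_r// subr_ge0 ltW.
by rewrite max_l// subr_le0.
Qed.

(** Integrating one coordinate at a time turns the indicator of a box into its
   volume, and integration commutes with countable sums of nonnegative functions.
   The weights c and d collect the sides already integrated. *)
Lemma box_sum_le (R : realType) (n : nat) (c : R) (a b : nat -> R)
    (d : nat -> R) (p q : nat -> nat -> R) :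
  0 <= c -> (forall k, 0 <= d k) ->
  (forall x : nat -> R, ((c * \prod_(i < n) \1_`]a i, b i] (x i))%:E <=
     \sum_(k <oo) (d k * \prod_(i < n) \1_`]p k i, q k i] (x i))%:E)%E) ->
  ((c * \prod_(i < n) Num.max 0 (b i - a i))%:E <=
     \sum_(k <oo) (d k * \prod_(i < n) Num.max 0 (q k i - p k i))%:E)%E.
Proof.
elim: n c d => [|n IH] c d c0 d0 le_cd.
  have := le_cd (fun=> 0); rewrite !big_ord0.
  under eq_eseriesr do rewrite big_ord0.
  by under [in X in _ -> X]eq_eseriesr do rewrite big_ord0.
have prod1_ge0 (s t : nat -> R) (x : nat -> R) :
    0 <= \prod_(i < n) \1_`]s i, t i] (x i) :> R.
  by apply: prodr_ge0.
have shuffle (e m r : R) : e * (m * r) = e * r * m by rewrite mulrA mulrAC.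
have pos_len (s t : R) : 0 <= Num.max 0 (t - s) by rewrite le_max lexx.
rewrite big_ord_recr/= shuffle.
under eq_eseriesr do rewrite big_ord_recr/= shuffle.
apply: IH => [|k|x]; [exact: mulr_ge0|exact: mulr_ge0|].
(* only the last coordinate of x varies *)
pose upd (t : R) i := if i == n then t else x i.
have updE (s t : nat -> R) v : \prod_(i < n) \1_`]s i, t i] (upd v i) =
    \prod_(i < n) \1_`]s i, t i] (x i) :> R.
  by apply: eq_bigr => i _; rewrite /upd ltn_eqF.
rewrite mulrAC -integral_scaled_itv ?mulr_ge0//.
under eq_eseriesr => k _.
  rewrite mulrAC -integral_scaled_itv ?mulr_ge0//.
  over.
rewrite -integral_nneseries//; last 2 first.
- move=> k; apply/measurable_EFinP; apply: measurable_funM => //.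
- by move=> k t _; rewrite lee_fin !mulr_ge0.
apply: ge0_le_integral => //.
- by move=> t _; rewrite lee_fin !mulr_ge0.
- by apply/measurable_EFinP; apply: measurable_funM.
- apply: ge0_emeasurable_sum => [k t _ _|k _].
    by rewrite lee_fin !mulr_ge0.
  by apply/measurable_EFinP; apply: measurable_funM.
move=> t _; apply: le_trans (le_trans (le_cd (upd t)) _).
  by rewrite big_ord_recr/= updE mulrA /upd eqxx.
by under eq_eseriesr do rewrite big_ord_recr/= updE mulrA /upd eqxx.
Qed.

(** This bound is what makes Lebesgue measure nontrivial: every positive mass
   used below comes from it. *)
Lemma box_vol_le_leb_outer (R : realType) (n : nat) (a b : 'rV[R]_n) :
  ((box_vol a b)%:E <= leb_outer (box a b))%E.
Proof.
apply: le_ereal_inf_tmp => _ [P [A [abA ->]]].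
pose ext (v : 'rV[R]_n) (j : nat) : R := if insub j is Some i then v ord0 i else 0.
have extE v (i : 'I_n) : ext v i = v ord0 i by rewrite /ext valK.
have box_indicE (s t : 'rV[R]_n) (x : nat -> R) :
    \prod_(i < n) \1_`]ext s i, ext t i] (x i) =
    \1_(box s t) (\row_i x i) :> R.
  rewrite [in RHS]indicE; case: (boolP (_ \in box s t)) => [/set_mem xst|xst].
    rewrite big1// => i _; rewrite indicE mem_set//= in_itv/= !extE.
    by have := xst i; rewrite mxE.
  have /existsNP[i /negP xi] : ~ forall i, s ord0 i < x i <= t ord0 i.
    move=> all; move/negP: xst; apply; apply/mem_set => i.
    by rewrite mxE.
  rewrite (bigD1 i)//= indicE !extE memNset ?mul0r//= in_itv/=.
  exact/negP.
have volE (s t : 'rV[R]_n) :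
    \prod_(i < n) Num.max 0 (ext t i - ext s i) = box_vol s t.
  by apply: eq_bigr => i _; rewrite !extE.
rewrite -[box_vol a b]mul1r -volE eseries_mkcond.
under eq_eseriesr => k _.
  rewrite (_ : (if P k then _ else _) =
    ((P k)%:R * \prod_(i < n) Num.max 0 (ext (A k).2 i - ext (A k).1 i))%:E); last first.
    by rewrite volE; case: (P k); rewrite ?mul1r ?mul0r.
  over.
apply: (@box_sum_le _ _ _ _ _ (fun k => (P k)%:R) (fun k => ext (A k).1)
  (fun k => ext (A k).2)) => // x; rewrite mul1r box_indicE.
rewrite [in leLHS]indicE; case: (boolP (_ \in box a b)) => [/set_mem|_].
  move=> /abA[k Pk xk]; rewrite (@nneseriesD1 _ _ k)//; last first.
    by move=> i _ ; rewrite lee_fin mulr_ge0// box_indicE.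
  rewrite box_indicE indicE mem_set//= Pk mul1r leeDl//.
  by apply: nneseries_ge0 => i _ _; rewrite lee_fin mulr_ge0// box_indicE.
by apply: nneseries_ge0 => k _ _; rewrite lee_fin mulr_ge0// box_indicE.
Qed.

(** * Euclidean geometry and reflections *)

Section euclidean_geometry.
Context (R : realType) (n : nat).
Implicit Types (x y z u v p : 'rV[R]_n).

Lemma dotC x y : dot x y = dot y x.
Proof. by apply: eq_bigr => i _; rewrite mulrC. Qed.

Lemma dotDl x y z : dot (x + y) z = dot x z + dot y z.
Proof. by rewrite /dot -big_split; apply: eq_bigr => i _; rewrite mxE mulrDl. Qed.

Lemma dotZl (a : R) x z : dot (a *: x) z = a * dot x z.
Proof. by rewrite /dot mulr_sumr; apply: eq_bigr => i _; rewrite mxE mulrA. Qed.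

Lemma dotNl x z : dot (- x) z = - dot x z.
Proof. by rewrite -scaleN1r dotZl mulN1r. Qed.

Lemma dotBl x y z : dot (x - y) z = dot x z - dot y z.
Proof. by rewrite dotDl dotNl. Qed.

Lemma dotDr x y z : dot z (x + y) = dot z x + dot z y.
Proof. by rewrite dotC dotDl !(dotC z). Qed.

Lemma dotZr (a : R) x z : dot z (a *: x) = a * dot z x.
Proof. by rewrite dotC dotZl (dotC z). Qed.

Lemma dotNr x z : dot z (- x) = - dot z x.
Proof. by rewrite dotC dotNl (dotC z). Qed.

Lemma dotBr x y z : dot z (x - y) = dot z x - dot z y.
Proof. by rewrite dotDr dotNr. Qed.

Lemma dot0l z : dot 0 z = 0.
Proof. by rewrite -(scale0r z) dotZl mul0r. Qed.

Lemma dot0r z : dot z 0 = 0.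
Proof. by rewrite dotC dot0l. Qed.

Definition dotE := (dotDl, dotDr, dotNl, dotNr, dotZl, dotZr).

Lemma dotxx_ge0 x : 0 <= dot x x.
Proof. by apply: sumr_ge0 => i _; rewrite -expr2 sqr_ge0. Qed.

Lemma dotxx_eq0 x : dot x x = 0 -> x = 0.
Proof.
move=> /eqP; rewrite psumr_eq0 => [/allP x0|i _]; last by rewrite -expr2 sqr_ge0.
apply/rowP => i; rewrite mxE.
by have := x0 i; rewrite mem_index_enum => /(_ isT); rewrite -expr2 sqrf_eq0 => /eqP.
Qed.

Lemma enorm_ge0 x : 0 <= enorm x. Proof. exact: sqrtr_ge0. Qed.

Lemma sqr_enorm x : enorm x ^+ 2 = dot x x.
Proof. by rewrite sqr_sqrtr ?dotxx_ge0. Qed.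

Lemma enormN x : enorm (- x) = enorm x.
Proof. by rewrite /enorm dotNl dotNr opprK. Qed.

Lemma enormBC x y : enorm (x - y) = enorm (y - x).
Proof. by rewrite -enormN opprB. Qed.

Lemma enormZ (a : R) x : enorm (a *: x) = `|a| * enorm x.
Proof.
by rewrite /enorm dotZl dotZr mulrA -expr2 sqrtrM ?sqr_ge0// sqrtr_sqr.
Qed.

Lemma enorm_le x (r : R) : 0 <= r -> (enorm x <= r) = (dot x x <= r ^+ 2).
Proof.
by move=> r0; rewrite -sqr_enorm ler_pXn2r// ?nnegrE// enorm_ge0.
Qed.

Lemma norm_coord_le x (i : 'I_n) : `|x ord0 i| <= enorm x.
Proof.
rewrite -(@ler_pXn2r _ 2)// ?nnegrE ?enorm_ge0// sqr_enorm real_normK ?num_real//.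
by rewrite /dot (bigD1 i)//= -expr2 lerDl sumr_ge0// => j _; rewrite -expr2 sqr_ge0.
Qed.

Lemma cauchy_schwarz x y : `|dot x y| <= enorm x * enorm y.
Proof.
rewrite -(@ler_pXn2r _ 2)// ?nnegrE ?mulr_ge0 ?enorm_ge0//.
rewrite real_normK ?num_real// exprMn !sqr_enorm.
have [y0|y0] := eqVneq (dot y y) 0.
  by rewrite (dotxx_eq0 y0) !dot0r expr0n mulr0.
have yy : 0 < dot y y by rewrite lt_neqAle eq_sym y0 dotxx_ge0.
have := dotxx_ge0 (dot y y *: x - dot x y *: y).
rewrite !dotE (dotC y x) => h.
rewrite -(ler_pM2l yy) -subr_ge0; apply: le_trans h _.
by rewrite le_eqVlt; apply/orP; left; apply/eqP; ring.
Qed.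

Lemma ler_enormD x y : enorm (x + y) <= enorm x + enorm y.
Proof.
rewrite enorm_le ?addr_ge0 ?enorm_ge0// !dotE (dotC y x) sqrrD !sqr_enorm.
have := le_trans (ler_norm _) (cauchy_schwarz x y); lra.
Qed.

Lemma ler_dist_enorm x y : `|enorm x - enorm y| <= enorm (x - y).
Proof.
have := ler_enormD (x - y) y; have := ler_enormD (y - x) x.
rewrite !subrK (enormBC y) => h1 h2.
by rewrite ler_norml; apply/andP; split; lra.
Qed.

Definition eball p (r : R) : set 'rV[R]_n := [set x | enorm (x - p) <= r].

Lemma eball_center p (r : R) : 0 <= r -> eball p r p.
Proof.
by move=> r0; rewrite /eball/= subrr /enorm dot0l sqrtr0.
Qed.

End euclidean_geometry.

Section reflection_geometry.
Context (R : realType) (n : nat) (u : 'rV[R]_n) (u1 : enorm u = 1).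
Implicit Types (x y p : 'rV[R]_n).

Lemma dot_unit : dot u u = 1.
Proof. by rewrite -sqr_enorm u1 expr1n. Qed.

Lemma dot_reflection x : dot (reflection u x) u = - dot x u.
Proof. by rewrite !dotE dot_unit; ring. Qed.

Lemma dot_reflection2 x y : dot (reflection u x) (reflection u y) = dot x y.
Proof. by rewrite !dotE dot_unit (dotC u y); ring. Qed.

Lemma reflectionK : involutive (reflection u).
Proof.
move=> x; rewrite {1}/reflection dot_reflection /reflection mulrN scaleNr opprK.
by rewrite subrK.
Qed.

Lemma reflectionB x y : reflection u (x - y) = reflection u x - reflection u y.
Proof.
apply/rowP => i; rewrite /reflection !mxE !dotE; ring.
Qed.

Lemma reflection_fix x : dot x u = 0 -> reflection u x = x.
Proof. by move=> xu; rewrite /reflection xu mulr0 scale0r subr0. Qed.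

Lemma enorm_reflection x : enorm (reflection u x) = enorm x.
Proof. by rewrite /enorm dot_reflection2. Qed.

Lemma reflection_unit : reflection u u = - u.
Proof. by rewrite /reflection dot_unit mulr1 scaler_nat mulr2n opprD addrA subrr sub0r. Qed.

Lemma enorm_reflectionB x y : enorm (reflection u x - y) = enorm (x - reflection u y).
Proof. by rewrite -{1}(reflectionK y) -reflectionB enorm_reflection. Qed.

Lemma eball_reflection p r x : eball p r (reflection u x) <-> eball (reflection u p) r x.
Proof. by rewrite /eball/= enorm_reflectionB. Qed.

Lemma reflectionN x : reflection (- u) x = reflection u x.
Proof. by rewrite /reflection dotNr scalerN mulrN scaleNr !opprK. Qed.

End reflection_geometry.

(** * Measure of balls *)

Section lebesgue_balls.
Context (R : realType) (n : nat).
Implicit Types (x v p : 'rV[R]_n).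

Lemma measurable_coord (i : 'I_n) :
  measurable_fun setT (fun x : lebRn R n => (x : 'rV[R]_n) ord0 i).
Proof.
move=> mT; apply: (measurability _ (RGenOInfty.measurableE R)) => // _ [_ [c ->] <-].
rewrite setTI [X in measurable X](_ : _ =
    ~` [set x : 'rV[R]_n | x ord0 i <= c]).
  by apply: measurableC; exact: measurable_half_space.
by apply/seteqP; split => x /=; rewrite in_itv/= andbT ltNge => /negP.
Qed.

Lemma measurable_dot v :
  measurable_fun setT (fun x : lebRn R n => dot (x : 'rV[R]_n) v).
Proof.
apply: measurable_sum => i; apply: measurable_funM.
  exact: measurable_coord.
exact: measurable_cst.
Qed.

Lemma measurable_enormB p :
  measurable_fun setT (fun x : lebRn R n => enorm ((x : 'rV[R]_n) - p)).
Proof.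
apply: (@measurableT_comp _ _ _ _ _ _ (@Num.sqrt R)).
  by apply: continuous_measurable_fun; exact: sqrt_continuous.
have mB i : measurable_fun setT (fun x : lebRn R n => ((x : 'rV[R]_n) - p) ord0 i).
  rewrite (_ : (fun _ => _) = (fun x : lebRn R n => (x : 'rV[R]_n) ord0 i - p ord0 i)).
    by apply: measurable_funB; [exact: measurable_coord|exact: measurable_cst].
  by apply/funext => x; rewrite !mxE.
by rewrite /dot; apply: measurable_sum => i; apply: measurable_funM; exact: mB.
Qed.

Lemma measurable_eball p r : measurable (eball p r : set (lebRn R n)).
Proof.
rewrite [X in measurable X](_ : _ =
    [set: lebRn R n] `&` (fun x => enorm ((x : 'rV[R]_n) - p)) @^-1` `]-oo, r]).
  exact: measurable_enormB.
by rewrite setTI; apply/seteqP; split => x; rewrite /eball/= in_itv.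
Qed.

Lemma leb_eball_gt0 p (r : R) : 0 < r -> (0 < leb (eball p r : set (lebRn R n)))%E.
Proof.
move=> r0.
pose d := r / n.+1%:R.
have d0 : 0 < d by rewrite divr_gt0.
apply: (@lt_le_trans _ _ (leb (box (p - const_mx d) (p + const_mx d) : set (lebRn R n)))).
  apply: lt_le_trans (box_vol_le_leb_outer _ _).
  rewrite lte_fin; apply: prodr_gt0 => i _; rewrite !mxE lt_max; apply/orP; right.
  lra.
apply: leb_outer_homo => x xp; rewrite /eball/= enorm_le; last exact: ltW.
apply: (@le_trans _ _ (\sum_(i < n) d ^+ 2)).
  apply: ler_sum => i _; have := xp i; rewrite !mxE => /andP[h1 h2].
  rewrite -expr2 -real_normK ?num_real// ler_pXn2r ?nnegrE//; last exact: ltW.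
  rewrite ler_norml.
  by apply/andP; split; lra.
rewrite sumr_const card_ord -mulr_natl /d exprMn mulrCA ler_piMr ?sqr_ge0//.
rewrite exprVn ler_pdivrMr ?exprn_gt0// mul1r -natrX ler_nat.
by rewrite expnS expn1 (leq_trans (leqnSn n))// leq_pmulr.
Qed.

Lemma leb_eball_lty p r : (leb (eball p r : set (lebRn R n)) < +oo)%E.
Proof.
apply: (@le_lt_trans _ _ (leb (box (p - const_mx (r + 1)) (p + const_mx (r + 1))
    : set (lebRn R n)))); last first.
  by apply: le_lt_trans (leb_outer_box _ _) _; rewrite ltry.
apply: leb_outer_homo => x; rewrite /eball/= => xp i; rewrite !mxE.
have := le_trans (norm_coord_le (x - p) i) xp; rewrite !mxE ler_norml => /andP[h1 h2].
by apply/andP; split; lra.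
Qed.
End lebesgue_balls.

(** * Functions constant off a set of finite measure *)

Definition domain (R : realType) (k : space_kind) : set R :=
  match k with
  | KindM | KindS => setT
  | KindMplus | KindV => [set s | 0 <= s]
  end.

(** A value that functions of the space may keep off a set of finite measure; in
   the two nonnegative spaces the value 0 is enough. *)
Definition base_value (R : realType) (k : space_kind) (c : R) : Prop :=
  match k with
  | KindM | KindS => True
  | KindMplus | KindV => c = 0
  end.

Section spaces.
Context (R : realType) (n : nat) (k : space_kind).
Implicit Types (x : 'rV[R]_n) (s t c : R).
Local Notation X := (@function_space R n k).

Lemma leb_setT_gt0 : (0 < leb [set: lebRn R n])%E.
Proof.
apply: lt_le_trans (leb_eball_gt0 0 ltr01) _; exact: leb_outer_homo.
Qed.

Lemma measurable_of_space (f : 'rV[R]_n -> R) :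
  X f -> measurable_fun setT (f : lebRn R n -> R).
Proof. by rewrite /function_space; case: k => // [[]|[]|[[]]]. Qed.

Lemma base_add_in_space c (g : 'rV[R]_n -> R) (B : set 'rV[R]_n) :
  base_value k c -> measurable_fun setT (g : lebRn R n -> R) ->
  (forall x, 0 <= g x) -> (forall x, ~ B x -> g x = 0) ->
  (leb (B : set (lebRn R n)) < +oo)%E -> X (fun x => c + g x).
Proof.
move=> ck mg g0 gB Bfin.
pose f x : R := c + g x; rewrite -/f.
have mf : measurable_fun setT (f : lebRn R n -> R).
  by apply: measurable_funD => //; exact: measurable_cst.
have level t : c <= t -> (leb (superlevel f t) < +oo)%E.
  move=> ct; apply: le_lt_trans Bfin; apply: leb_outer_homo => x.
  rewrite /superlevel/= /f => tg; apply: contrapT => /gB gx; move: tg.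
  by rewrite gx; lra.
case: k ck => /= ck.
- exact: mf.
- by split=> // x; rewrite /f ck add0r.
- split=> // t tinf; apply: level; rewrite leNgt; apply/negP => tc.
  move: tinf; apply/negP; rewrite -leNgt.
  apply: ereal_sup_ubound => /=; apply: aeW => x.
  by rewrite lee_fin (le_trans (ltW tc))// lerDl.
- split; first by split=> // x; rewrite /f ck add0r.
  by move=> t t0; apply: level; rewrite ck ltW.
Qed.

Lemma cst_in_space c : base_value k c -> X (fun=> c).
Proof.
move=> ck; rewrite (_ : (fun=> c) = (fun x : 'rV[R]_n => c + 0)); last first.
  by apply/funext => x; rewrite addr0.
apply: (@base_add_in_space c (fun=> 0) set0) => //.
by rewrite measure0.
Qed.

Lemma base_value_domain c : base_value k c -> domain k c.
Proof. by case: k => //= ->. Qed.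

(** The distribution function of T f says nothing about the values below the base
   value. Either the base value leaves room below s and t, which forces the values
   of T f above it, or the domain itself stays above it. *)
Lemma exists_floor s t : domain k s -> domain k t ->
  exists c, [/\ base_value k c, c <= s, c <= t &
    (c < s /\ c < t) \/ forall v : R, domain k v -> c <= v].
Proof.
have low : exists c, [/\ c <= s, c <= t, c < s & c < t].
  have [st|ts] := leP s t; [exists (s - 1)|exists (t - 1)]; split; lra.
case: k low => /= -[c [cs ct cs' ct']]; try (by exists c; split => //; left).
- by move=> *; exists 0; split => //; right.
- by move=> *; exists 0; split => //; right.
Qed.

(** When B is the mirror image of A, the pair formed by the values at a point and
   at its image is (s, t), (t, s) or (c, c): such functions isolate one pair of
   arguments of F+ and F-. *)
Definition two_valued (A B : set 'rV[R]_n) c s t x : R :=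
  c + ((s - c) * \1_A x + (t - c) * \1_B x).

Lemma two_valued_in_space (A B : set 'rV[R]_n) c s t :
  measurable (A : set (lebRn R n)) -> measurable (B : set (lebRn R n)) ->
  (leb (A : set (lebRn R n)) < +oo)%E -> (leb (B : set (lebRn R n)) < +oo)%E ->
  base_value k c -> c <= s -> c <= t -> X (two_valued A B c s t).
Proof.
move=> mA mB Afin Bfin ck cs ct.
apply: (@base_add_in_space c _ (A `|` B)); first exact: ck.
- by apply: measurable_funD; apply: measurable_funM;
    [exact: measurable_cst|exact: measurable_indic
    |exact: measurable_cst|exact: measurable_indic].
- by move=> x; rewrite addr_ge0// mulr_ge0// subr_ge0.
- by move=> x /not_orP[xA xB]; rewrite !indicE !memNset// !mulr0 addr0.
- apply: le_lt_trans (lte_add_pinfty Afin Bfin).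
  exact: measureU2.
Qed.
End spaces.

(** * A pair of mirror balls *)

Section mirror_balls.
Context (R : realType) (n : nat) (u : 'rV[R]_n) (u1 : enorm u = 1).
Implicit Types (x : 'rV[R]_n).

Lemma eball_pos (r : R) x : r < 1 -> eball u r x -> 0 < dot x u.
Proof.
move=> r1; rewrite /eball/= => xr; rewrite -(subrK u x) dotDl dot_unit//.
have := cauchy_schwarz (x - u) u; rewrite u1 mulr1 ler_norml => /andP[h _]; lra.
Qed.

Lemma eball_mirror (r : R) x : eball (- u) r x <-> eball u r (reflection u x).
Proof. by rewrite -(reflection_unit u1); split=> /eball_reflection; apply. Qed.

Lemma eball_neg (r : R) x : r < 1 -> eball (- u) r x -> dot x u < 0.
Proof.
by move=> r1 /eball_mirror/(eball_pos r1); rewrite dot_reflection// oppr_gt0.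
Qed.

Definition plus_ball := eball u 2^-1.
Definition minus_ball := eball (- u) 2^-1.

Lemma plus_ball_pos x : plus_ball x -> 0 < dot x u.
Proof. by apply: eball_pos; lra. Qed.

Lemma minus_ball_neg x : minus_ball x -> dot x u < 0.
Proof. by apply: eball_neg; lra. Qed.

Lemma two_valued_plus (c s t : R) x :
  plus_ball x -> two_valued plus_ball minus_ball c s t x = s.
Proof.
move=> xP; have xN : ~ minus_ball x.
  move=> /(minus_ball_neg) h; have := plus_ball_pos xP; lra.
by rewrite /two_valued !indicE mem_set// memNset// mulr1 mulr0 addr0 addrC subrK.
Qed.

Lemma two_valued_minus (c s t : R) x :
  minus_ball x -> two_valued plus_ball minus_ball c s t x = t.
Proof.
move=> xN; have xP : ~ plus_ball x.
  move=> /(plus_ball_pos) h; have := minus_ball_neg xN; lra.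
by rewrite /two_valued !indicE memNset// mem_set// mulr1 mulr0 add0r addrC subrK.
Qed.

Lemma two_valued_out (c s t : R) x : ~ plus_ball x -> ~ minus_ball x ->
  two_valued plus_ball minus_ball c s t x = c.
Proof. by move=> xP xN; rewrite /two_valued !indicE !memNset// !mulr0 !addr0. Qed.

Lemma plus_ball_mirror x : plus_ball (reflection u x) <-> minus_ball x.
Proof. by split=> /eball_mirror. Qed.

Lemma minus_ball_mirror x : minus_ball (reflection u x) <-> plus_ball x.
Proof. by rewrite -plus_ball_mirror reflectionK. Qed.

Lemma measurable_plus_ball : measurable (plus_ball : set (lebRn R n)).
Proof. exact: measurable_eball. Qed.

Lemma measurable_minus_ball : measurable (minus_ball : set (lebRn R n)).
Proof. exact: measurable_eball. Qed.

Lemma center_plus_ball : plus_ball u. Proof. exact: eball_center. Qed.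

Lemma center_minus_ball : minus_ball (- u). Proof. exact: eball_center. Qed.

Lemma plus_minus_disjoint : plus_ball `&` minus_ball = set0.
Proof.
apply/seteqP; split => // x [/(plus_ball_pos) h1 /(minus_ball_neg)]; lra.
Qed.

Lemma leb_superlevel_two_valued (c a b tau : R) : c <= tau ->
  leb (superlevel (two_valued plus_ball minus_ball c a b) tau) =
  ((if (tau < a)%R then leb (plus_ball : set (lebRn R n)) else 0) +
   (if (tau < b)%R then leb (minus_ball : set (lebRn R n)) else 0))%E.
Proof.
move=> ctau.
pose A (w : R) (B : set (lebRn R n)) := if tau < w then B else set0.
have mA w (B : set (lebRn R n)) : measurable B -> measurable (A w B).
  by rewrite /A; case: ifP.
have lA w (B : set (lebRn R n)) : leb (A w B) = if tau < w then leb B else 0%E.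
  by rewrite /A; case: ifP => //; rewrite measure0.
have -> : superlevel (two_valued plus_ball minus_ball c a b) tau =
    A a plus_ball `|` A b minus_ball.
  rewrite /superlevel /A; apply/seteqP; split => x /=.
    have [xP|xP] := pselect (plus_ball x).
      by rewrite two_valued_plus// => ->; left.
    have [xN|xN] := pselect (minus_ball x).
      by rewrite two_valued_minus// => ->; right.
    by rewrite two_valued_out// ltNge ctau.
  by case; case: ifP => // h xB; [rewrite two_valued_plus|rewrite two_valued_minus].
rewrite -!lA -measureU//.
- exact/mA/measurable_plus_ball.
- exact/mA/measurable_minus_ball.
- apply/seteqP; split => // x [].
  rewrite /A; case: ifP => // _ xP; case: ifP => // _ xN.
  by have : set0 x by rewrite -plus_minus_disjoint.
Qed.
End mirror_balls.

(** Each level reached by one of two bumps of positive masses can be read off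
   the distribution function, so the two heights are determined as a set. *)
Lemma two_levels (R : realType) (m1 m2 : \bar R) (c a b s t : R) :
  (0 < m1)%E -> (m1 < +oo)%E -> (0 < m2)%E -> (m2 < +oo)%E ->
  c <= a -> c <= b -> c <= s -> c <= t ->
  (forall tau, c <= tau ->
    ((if (tau < a)%R then m1 else 0) + (if (tau < b)%R then m2 else 0) =
     (if (tau < s)%R then m1 else 0) + (if (tau < t)%R then m2 else 0))%E) ->
  (a = s /\ b = t) \/ (a = t /\ b = s).
Proof.
wlog ab : m1 m2 a b s t / a <= b.
  move=> H m10 m1y m20 m2y ca cb cs ct E.
  have [ab|/ltW ba] := leP a b; first exact: (H m1 m2).
  suff : (b = t /\ a = s) \/ (b = s /\ a = t) by case=> -[-> ->]; [left|right].
  by apply: (H m2 m1) => // tau /E; rewrite addeC [RHS]addeC.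
case: m1 => // m1; case: m2 => // m2; rewrite !lte_fin => m10 _ m20 _.
move=> ca cb cs ct E.
have {}E tau : c <= tau -> (if tau < a then m1 else 0) + (if tau < b then m2 else 0) =
     (if tau < s then m1 else 0) + (if tau < t then m2 else 0).
  by move=> /E/(congr1 fine); do 4 case: ifP => _.
move: (E a ca) (E b cb) (E s cs) (E t ct) => {E}; rewrite !ltxx (ltNge b) ab/=.
have [sb|bs] := leP s b; last by move=> _; case: ifP => _ *; exfalso; lra.
have [tb|bt] := leP t b; last by move=> _ *; exfalso; lra.
case: (ltrgtP a b) ab => // [ab|eab] _; last first.
  subst b; move=> _ _.
  case: (ltrgtP s a) sb => // [sa _|ea _]; first by case: ifP => _ *; exfalso; lra.
  case: (ltrgtP t a) tb => // [ta _|ea' _]; last by left.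
  by case: (t < s); case: (s < t) => *; exfalso; lra.
have [ias|ias] := ltP a s; have [iat|iat] := ltP a t; try by move=> *; exfalso; lra.
- move=> _ _; case: (ltrgtP s b) sb => // [sb _|eb _]; last first.
    case: (ltrgtP t a) iat => // [ta _|ea _]; last by right.
    by rewrite (lt_trans ta ab) (lt_trans ta ias) => *; exfalso; lra.
  by rewrite (ltNge s a) (ltW ias)/= (ltNge s t) (le_trans iat (ltW ias))/= => *; exfalso; lra.
- move=> _ _; case: (ltrgtP t b) tb => // [tb _|eb _]; last first.
    case: (ltrgtP s a) ias => // [sa _|ea _]; last by left.
    by rewrite (lt_trans sa ab) (lt_trans sa iat) => *; exfalso; lra.
  move=> _; rewrite (ltNge t a) (ltW iat)/= (ltNge t s) (le_trans ias (ltW iat))/=.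
  by move=> *; exfalso; lra.
Qed.

(** * Piecewise linear test functions *)

Section continuity.
Context (R : realType).

Lemma continuous_minr (V : topologicalType) (f g : V -> R) :
  continuous f -> continuous g -> continuous (fun x => Num.min (f x) (g x)).
Proof.
move=> cf cg x; rewrite (_ : (fun _ => _) = (fun y => (f y + g y - `|f y - g y|) / 2)).
  apply: cvgMl; apply: cvgB; first by apply: cvgD; [exact: cf|exact: cg].
  by apply: cvg_norm; apply: cvgB; [exact: cf|exact: cg].
by apply/funext => y; rewrite minr_absE.
Qed.

Lemma continuous_maxr (V : topologicalType) (f g : V -> R) :
  continuous f -> continuous g -> continuous (fun x => Num.max (f x) (g x)).
Proof.
move=> cf cg x; rewrite (_ : (fun _ => _) = (fun y => (f y + g y + `|f y - g y|) / 2)).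
  apply: cvgMl; apply: cvgD; first by apply: cvgD; [exact: cf|exact: cg].
  by apply: cvg_norm; apply: cvgB; [exact: cf|exact: cg].
by apply/funext => y; rewrite maxr_absE.
Qed.

Lemma continuous_dot (n : nat) (v : 'rV[R]_n) : continuous (fun x : 'rV[R]_n => dot x v).
Proof.
rewrite /dot; apply: continuous_big => [|i _ x]; first exact: add_continuous.
apply: cvgMl; [exact: nbhs_filter|exact: coord_continuous].
Qed.
End continuity.

Section min_of_affine.
Context (R : realType) (n m : nat).
Context (v : 'I_m.+1 -> 'rV[R]_n) (b : 'I_m.+1 -> R).
Implicit Types (x : 'rV[R]_n).

Let a (i : 'I_m.+1) x := dot x (v i) + b i.

Definition min_affine x := \big[Num.min/a ord0 x]_(i < m.+1) a i x.

Lemma min_affineP x : exists j, min_affine x = a j x /\ forall i, a j x <= a i x.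
Proof.
have min_le i : min_affine x <= a i x by exact: bigmin_le.
suff [j E] : exists j, min_affine x = a j x.
  by exists j; split => // i; rewrite -E.
rewrite /min_affine; elim/big_ind: _ => [|_ _ [i ->] [j ->]|i _].
- by exists ord0.
- by case: (leP (a i x) (a j x)) => _; [exists i|exists j].
- by exists i.
Qed.

Lemma continuous_min_affine : continuous min_affine.
Proof.
have ca i : continuous (a i).
  move=> x; apply: cvgD; [exact: nbhs_filter|exact: continuous_dot|exact: (@cst_continuous _ _ (b i))].
rewrite /min_affine; elim: (index_enum _) => [|i r IH].
  by under eq_fun do rewrite big_nil; exact: ca.
by under eq_fun do rewrite big_cons; exact: continuous_minr.
Qed.

Lemma measurable_min_affine : measurable_fun setT (min_affine : lebRn R n -> R).
Proof.
have ma i : measurable_fun setT (a i : lebRn R n -> R).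
  by apply: measurable_funD; [exact: measurable_dot|exact: measurable_cst].
rewrite /min_affine; elim: (index_enum _) => [|i r IH].
  by under eq_fun do rewrite big_nil; exact: ma.
by under eq_fun do rewrite big_cons; exact: measurable_minr.
Qed.

(** The function is affine where a given affine piece is the least one and
   nonnegative, and constant where a given affine piece is nonpositive; these
   polyhedra cover the space. *)
Lemma piecewise_linear_min_affine c :
  piecewise_linear (fun x => c + Num.max 0 (min_affine x)).
Proof.
pose P (i : 'I_(m.+1 + m.+1)) : set 'rV[R]_n := match fintype.split i with
  | inl j => [set x | 0 <= a j x /\ forall i, a j x <= a i x]
  | inr j => [set x | a j x <= 0]
  end.
exists (m.+1 + m.+1)%N, P,
  (fun i => match fintype.split i with inl j => v j | inr j => 0 end),
  (fun i => match fintype.split i with inl j => c + b j | inr j => c end); split.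
- rewrite /P => i; case: (fintype.split i) => j.
    (* the slot i = j, where the comparison is void, carries the sign condition *)
    exists m.+1, (fun i => if i == j then - v j else v j - v i),
      (fun i => if i == j then b j else b i - b j).
    apply/seteqP; split => x /=; rewrite /a.
      move=> [h0 h] l; case: eqP => [_|_]; rewrite !dotE; first by lra.
      by have := h l; lra.
    move=> h; have h0 : 0 <= dot x (v j) + b j.
      by have := h j; rewrite eqxx dotNr; lra.
    split => // l; have := h l; case: eqP => [->//|_]; rewrite !dotE; lra.
  exists 1%N, (fun=> v j), (fun=> - b j); apply/seteqP; split => x /=; rewrite /a.
    by move=> h _; lra.
  by move/(_ ord0); lra.
- move=> x; have [j [_ jmin]] := min_affineP x.
  have [j0|j0] := leP 0 (a j x).
    by exists (unsplit (inl j)); rewrite /P unsplitK.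
  by exists (unsplit (inr j)); rewrite /P unsplitK /= ltW.
- rewrite /P => i x; have [l [-> lmin]] := min_affineP x.
  case: (fintype.split i) => j /=.
    move=> [j0 jmin]; have -> : a l x = a j x by apply/le_anti; rewrite lmin jmin.
    by rewrite max_r// /a; lra.
  by move=> j0; rewrite max_l ?dot0r ?addr0 ?add0r// (le_trans (lmin j)).
Qed.
End min_of_affine.

Lemma dot_delta (R : realType) (n : nat) (x : 'rV[R]_n) (i : 'I_n) :
  dot x (delta_mx ord0 i) = x ord0 i.
Proof.
rewrite /dot (bigD1 i)//= mxE !eqxx mulr1 big1 ?addr0// => j ji.
by rewrite mxE (negbTE ji) andbF mulr0.
Qed.

Lemma scalar_dot (R : realType) (n : nat) (f : 'rV[R]_n -> R) :
  scalar f -> exists w, f = (fun x => dot x w).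
Proof.
move=> sf.
have f0 : f 0 = 0 by have := sf 1 0 0; rewrite scaler0 addr0; lra.
exists (\row_i f (delta_mx ord0 i)); apply/funext => x.
rewrite {1}(row_sum_delta x) /dot.
elim/big_rec2: _ => [//|i y z _ <-].
by rewrite sf mxE.
Qed.

Lemma test_function_in_space (R : realType) (n : nat) (k : space_kind)
  (f : 'rV[R]_n -> R) : test_function k f -> function_space k f.
Proof.
case: k => [/scalar_dot[w ->]|[]|[]|[]]//=; exact: measurable_dot.
Qed.

Lemma continuous_test_function (R : realType) (n : nat) (k : space_kind)
  (f : 'rV[R]_n -> R) : test_function k f -> continuous f.
Proof.
case: k => [/scalar_dot[w ->]|[]|[]|[]]//=; exact: continuous_dot.
Qed.

(** Every linear function agrees with a test function on any bounded region
   where it stays above the base value: cut it off below at the base value,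
   and above by a pyramid of slope one. *)
Lemma test_function_linear (R : realType) (n : nat) (k : space_kind)
    (v : 'rV[R]_n) (c K : R) : base_value k c ->
  exists2 f, test_function k f &
    forall x, enorm x <= K -> dot x v <= K -> c <= dot x v -> f x = dot x v.
Proof.
move=> ck.
have linear : exists2 f : 'rV[R]_n -> R, scalar f & forall x, f x = dot x v.
  by exists (fun x => dot x v) => // z x y; rewrite dotDl dotZl.
pose M := K + K + `|c|.
pose w (j : 'I_(n + n).+1) := if unlift ord0 j is Some l then
  match fintype.split l with
  | inl i => - delta_mx ord0 i | inr i => delta_mx ord0 i : 'rV[R]_n end else v.
pose b (j : 'I_(n + n).+1) := if unlift ord0 j is Some l then M else - c.
pose f x := c + Num.max 0 (min_affine w b x).
have cut_off (k' : space_kind) : base_value k' c ->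
    [/\ function_space k' f, piecewise_linear f & continuous f].
  move=> ck'; split.
  - apply: (@base_add_in_space _ _ _ _ _ (eball 0 (n%:R * `|M|))); first exact: ck'.
    + apply: measurable_maxr; first exact: measurable_cst.
      exact: measurable_min_affine.
    + by move=> x; rewrite le_max lexx.
    + move=> x xM; apply: max_l; rewrite leNgt; apply/negP => pos; apply: xM.
      have coord i : `|x ord0 i| < `|M|.
        have [j [Ej jmin]] := min_affineP w b x.
        have h1 := jmin (lift ord0 (lshift n i)).
        have h2 := jmin (lift ord0 (rshift n i)).
        move: h1 h2; rewrite -Ej /w /b !liftK (unsplitK (inl i)) (unsplitK (inr i)).
        rewrite dotNr dot_delta => h1 h2.
        by apply: lt_le_trans (ler_norm _); rewrite ltr_norml; apply/andP; split; lra.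
      rewrite /eball/= subr0 enorm_le ?mulr_ge0//.
      apply: (@le_trans _ _ (\sum_(i < n) `|M| ^+ 2)).
        apply: ler_sum => i _; rewrite -expr2 -real_normK ?num_real//.
        by rewrite ler_pXn2r ?nnegrE// ltW.
      rewrite sumr_const card_ord exprMn -[leLHS]mulr_natl ler_wpM2r ?sqr_ge0//.
      by rewrite -natrX ler_nat; case: (n) => // m; rewrite expnS expn1 leq_pmulr.
    + exact: leb_eball_lty.
  - exact: piecewise_linear_min_affine.
  - move=> x; apply: cvgD; [exact: nbhs_filter|exact: (@cst_continuous _ _ c)|].
    apply: continuous_maxr; first exact: (@cst_continuous _ _ 0).
    exact: continuous_min_affine.
have f_lin x : enorm x <= K -> dot x v <= K -> c <= dot x v -> f x = dot x v.
  move=> xK vK cv; have [j [Ej jmin]] := min_affineP w b x.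
  have w0 : w ord0 = v by rewrite /w unlift_none.
  have b0 : b ord0 = - c by rewrite /b unlift_none.
  suff E : min_affine w b x = dot x v - c by rewrite /f E max_r ?subr_ge0//; lra.
  apply/le_anti/andP; split; first by rewrite Ej (le_trans (jmin ord0))// w0 b0.
  rewrite Ej /w /b; case: (unliftP ord0 j) => [l|] _; last by [].
  have := ler_norm (- c); rewrite normrN => hc.
  case: (fintype.split l) => i; rewrite ?dotNr dot_delta;
    have := le_trans (norm_coord_le x i) xK; rewrite ler_norml /M => /andP[h1 h2]; lra.
case: k ck => ck.
- by have [g sg gv] := linear; exists g => // x _ _ _.
- by exists f => //; exact: (cut_off KindMplus).
- by exists f => //; exact: (cut_off KindS).
- by exists f => //; exact: (cut_off KindV).
Qed.

(** * Comparing Lp norms *)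

Section Lnorm_facts.
Context d (T : measurableType d) (R : realType).
Context (mu : {measure set T -> \bar R}).
Implicit Types (f g : T -> R) (p : \bar R).
Local Open Scope ereal_scope.

Lemma Lnorm_le_of_integral (r : R) f g : (0 < r)%R ->
  \int[mu]_x (`|f x| `^ r)%:E <= \int[mu]_x (`|g x| `^ r)%:E ->
  'N[mu]_r%:E[EFin \o f] <= 'N[mu]_r%:E[EFin \o g].
Proof.
move=> r0 fg; rewrite unlock; apply: gt0_ler_poweR.
- by rewrite invr_ge0 ltW.
- by rewrite in_itv/= leey andbT integral_ge0// => x _; rewrite poweR_ge0.
- by rewrite in_itv/= leey andbT integral_ge0// => x _; rewrite poweR_ge0.
- exact: fg.
Qed.

Lemma measurable_norm_powR (r : R) f : measurable_fun setT f ->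
  measurable_fun setT (fun x => (`|f x| `^ r)%:E).
Proof.
move=> mf; apply/measurable_EFinP.
by apply: (@measurableT_comp _ _ _ _ _ _ (@powR R ^~ r)) => //; exact: measurableT_comp.
Qed.

Lemma Lnorm_le p f g : 1 <= p ->
  measurable_fun setT f -> measurable_fun setT g ->
  (forall x, (`|f x| <= `|g x|)%R) ->
  'N[mu]_p[EFin \o f] <= 'N[mu]_p[EFin \o g].
Proof.
case: p => [r||//] r1 mf mg fg.
  have r0 : (0 < r)%R by rewrite (lt_le_trans ltr01).
  apply: Lnorm_le_of_integral => //; apply: ge0_le_integral => //.
  - exact: measurable_norm_powR.
  - exact: measurable_norm_powR.
  - by move=> x _; rewrite lee_fin ge0_ler_powR ?nnegrE// ltW.
rewrite unlock; case: ifPn => // _; apply: le_ess_sup; apply: aeW => x /=.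
by rewrite lee_fin.
Qed.

Lemma Lnorm_indic p (A : set T) : 1 <= p -> measurable A -> 0 < mu A -> mu A < +oo ->
  exists2 m : R, (0 < m)%R & forall c : R, (0 <= c)%R ->
    'N[mu]_p[EFin \o (fun x => c * \1_A x)%R] = (c * m)%:E.
Proof.
move=> p1 mA A0 Ay.
have Afin : mu A \is a fin_num by rewrite ge0_fin_numE.
case: p p1 => [r||//] r1; rewrite unlock.
  have r0 : (0 < r)%R by rewrite (lt_le_trans ltr01).
  exists (fine (mu A) `^ r^-1)%R.
    by rewrite powR_gt0// fine_gt0// A0 Ay.
  move=> c c0.
  rewrite (_ : \int[mu]_x _ = \int[mu]_x ((c `^ r)%:E * (\1_A x)%:E)); last first.
    apply: eq_integral => x _ /=; rewrite -EFinM; congr EFin.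
    rewrite normrM powRM// ger0_norm// indicE; case: (x \in A) => /=.
      by rewrite normr1 powR1.
    by rewrite normr0 powR0// gt_eqF.
  rewrite ge0_integralZl//=; last 2 first.
    by apply/measurable_EFinP; exact: measurable_indic.
    by rewrite lee_fin powR_ge0.
  rewrite integral_indic// setIT -(fineK Afin) -EFinM poweR_EFin powRM ?powR_ge0 ?fine_ge0//.
  by rewrite -powRrM divff ?gt_eqF// powRr1.
exists 1%R => // c c0; have T0 : 0 < mu setT.
  by apply: lt_le_trans A0 _; apply: le_measure; rewrite ?inE.
rewrite T0 mulr1; apply/le_anti/andP; split.
  apply/ess_supP; apply: aeW => x /=; rewrite lee_fin normrM ger0_norm// ger0_norm ?indicE//.
  by case: (x \in A); rewrite ?mulr1// mulr0.
apply: le_ereal_inf_tmp => y /= [N [mN N0 yN]]; rewrite leNgt; apply/negP => yc.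
move: A0; apply/negP; rewrite -leNgt -N0; apply: le_measure; rewrite ?inE//.
move=> x Ax; apply: yN => /=; rewrite indicE mem_set// mulr1 ger0_norm// leNgt.
by rewrite yc.
Qed.
End Lnorm_facts.

(** * Pointwise equimeasurable maps *)

Section pointwise_equimeasurable.
Context (R : realType) (n : nat) (u : 'rV[R]_n) (u1 : enorm u = 1).
Context (k : space_kind) (T : ('rV[R]_n -> R) -> 'rV[R]_n -> R).
Context (Fp Fm : R * R -> R).
Local Notation X := (@function_space R n k).
Local Notation D := (@domain R k).
Local Notation tv := (two_valued (plus_ball u) (minus_ball u)).
Context (T_pointwise : pointwise_map X u T Fp Fm).
Context (T_equimeasurable : equimeasurable X T).
Implicit Types (x : 'rV[R]_n) (f : 'rV[R]_n -> R) (c s t : R).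

Lemma domain_value f x : X f -> D (f x).
Proof. by case: k => //= [[]|[[]]]. Qed.

Lemma tv_in_space c s t : base_value k c -> c <= s -> c <= t -> X (tv c s t).
Proof.
apply: two_valued_in_space; [exact: measurable_plus_ball
  |exact: measurable_minus_ball|exact: leb_eball_lty|exact: leb_eball_lty].
Qed.

Lemma value_setE : value_set X = D.
Proof.
apply/seteqP; split => [_ [f Xf [x _ <-]]|s Ds]; first exact: domain_value.
have [c [ck cs _ _]] := exists_floor Ds Ds.
exists (tv c s s); first exact: tv_in_space.
by exists u => //; rewrite two_valued_plus//; exact: center_plus_ball.
Qed.

Lemma Fp_domain s t : D s -> D t -> D (Fp (s, t)).
Proof. by rewrite -value_setE => Ds Dt; have [/(_ s t Ds Dt)[]] := T_pointwise. Qed.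

Lemma Fm_domain s t : D s -> D t -> D (Fm (s, t)).
Proof. by rewrite -value_setE => Ds Dt; have [/(_ s t Ds Dt)[]] := T_pointwise. Qed.

Lemma F_diag s : D s -> Fp (s, s) = Fm (s, s).
Proof. by rewrite -value_setE => Ds; have [_ /(_ s Ds)] := T_pointwise. Qed.

Lemma T_pos f x : X f -> 0 <= dot x u -> T f x = Fp (f x, f (reflection u x)).
Proof. by move=> Xf xu; have [_ _ /(_ f Xf x)[/(_ xu)]] := T_pointwise. Qed.

Lemma T_neg f x : X f -> dot x u <= 0 -> T f x = Fm (f x, f (reflection u x)).
Proof. by move=> Xf xu; have [_ _ /(_ f Xf x)[_ /(_ xu)]] := T_pointwise. Qed.

(** A constant function is sent to a constant function, and constants are told
   apart by their distribution functions because the whole space has positive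
   measure. *)
Lemma Fp_base c : base_value k c -> Fp (c, c) = c.
Proof.
move=> ck; have Dc := base_value_domain ck.
have Xc : X (fun=> c) by exact: cst_in_space.
have Tc : T (fun=> c) = (fun=> Fp (c, c)).
  apply/funext => x; have [xu|xu] := leP 0 (dot x u); first by rewrite T_pos.
  by rewrite T_neg ?F_diag// ltW.
have E := T_equimeasurable Xc; rewrite Tc in E.
have levelE a b : a < b -> leb (@superlevel R n (fun=> b) a) = leb [set: lebRn R n] /\
    leb (@superlevel R n (fun=> a) a) = 0%E.
  move=> ab; split.
    by congr leb; apply/seteqP; split.
  by rewrite (_ : superlevel _ _ = set0) ?measure0//;
    apply/seteqP; split => // x; rewrite /superlevel/= ltxx.
have absurd := lt_eqF (leb_setT_gt0 R n).
case: (ltgtP (Fp (c, c)) c) => // h; have [h1 h2] := levelE _ _ h.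
  by have := E (Fp (c, c)); rewrite h1 h2 => /eqP; rewrite absurd.
by have := E c; rewrite h1 h2 => /esym/eqP; rewrite absurd.
Qed.

Lemma T_two_valued c s t : base_value k c -> c <= s -> c <= t ->
  T (tv c s t) = tv c (Fp (s, t)) (Fm (t, s)).
Proof.
move=> ck cs ct; have Xf := tv_in_space ck cs ct; apply/funext => x.
have [xP|xP] := pselect (plus_ball u x).
  have fx' : tv c s t (reflection u x) = t.
    by rewrite two_valued_minus//; apply/minus_ball_mirror.
  rewrite T_pos ?fx'; [|exact: Xf|exact: ltW (plus_ball_pos u1 xP)].
  by rewrite !(two_valued_plus _ _ _ _ xP).
have [xN|xN] := pselect (minus_ball u x).
  have fx' : tv c s t (reflection u x) = s.
    by rewrite two_valued_plus//; apply/plus_ball_mirror.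
  rewrite T_neg ?fx'; [|exact: Xf|exact: ltW (minus_ball_neg u1 xN)].
  by rewrite !(two_valued_minus _ _ _ _ xN).
rewrite [RHS]two_valued_out//.
have fx : tv c s t x = c by rewrite two_valued_out.
have fx' : tv c s t (reflection u x) = c.
  by rewrite two_valued_out//; [move/(plus_ball_mirror u1)|move/(minus_ball_mirror u1)].
have [xu|xu] := leP 0 (dot x u); first by rewrite T_pos// fx fx' Fp_base.
by rewrite T_neg ?ltW// fx fx' -F_diag ?Fp_base//; exact: base_value_domain.
Qed.

(** The image of a two-valued function is two-valued with the same base value, so
   the two heights can be compared through the distribution functions. *)
Lemma pair_choice s t : D s -> D t ->
  (Fp (s, t) = s /\ Fm (t, s) = t) \/ (Fp (s, t) = t /\ Fm (t, s) = s).
Proof.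
move=> Ds Dt; have [c [ck cs ct floor]] := exists_floor Ds Dt.
have P0 : (0 < leb (plus_ball u : set (lebRn R n)))%E by apply: leb_eball_gt0; lra.
have N0 : (0 < leb (minus_ball u : set (lebRn R n)))%E by apply: leb_eball_gt0; lra.
have Py : (leb (plus_ball u : set (lebRn R n)) < +oo)%E by exact: leb_eball_lty.
have Ny : (leb (minus_ball u : set (lebRn R n)) < +oo)%E by exact: leb_eball_lty.
have E tau : c <= tau -> _ := fun h => T_equimeasurable (tv_in_space ck cs ct) tau.
have {}E tau : c <= tau ->
    ((if (tau < Fp (s, t))%R then leb (plus_ball u : set (lebRn R n)) else 0) +
     (if (tau < Fm (t, s))%R then leb (minus_ball u : set (lebRn R n)) else 0) =
     (if (tau < s)%R then leb (plus_ball u : set (lebRn R n)) else 0) +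
     (if (tau < t)%R then leb (minus_ball u : set (lebRn R n)) else 0))%E.
  by move=> h; have := E tau h; rewrite T_two_valued// !leb_superlevel_two_valued.
have [cF cF'] : c <= Fp (s, t) /\ c <= Fm (t, s).
  case: floor => [[cs' ct']|floor]; last first.
    by split; apply: floor; [exact: Fp_domain|exact: Fm_domain].
  have := E c (lexx _); rewrite cs' ct'.
  move: P0 N0 Py Ny; case: (leb (plus_ball u : set _)) => // m1.
  case: (leb (minus_ball u : set _)) => // m2; rewrite !lte_fin => m10 m20 _ _.
  move=> /(congr1 fine).
  case: (ltP c (Fp (s, t))) => [/ltW h1|_]; case: (ltP c (Fm (t, s))) => [/ltW h2|_] //= h;
    exfalso; lra.
exact: (two_levels P0 Py N0 Ny cF cF' cs ct E).
Qed.

Lemma Fp_diag s : D s -> Fp (s, s) = s.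
Proof. by move=> Ds; case: (pair_choice Ds Ds) => -[]. Qed.

Lemma Fm_keep s t : D s -> D t -> Fp (s, t) = s -> Fm (t, s) = t.
Proof. by move=> Ds Dt E; case: (pair_choice Ds Dt) => -[]// <- ->; rewrite E. Qed.

Lemma Fm_swap s t : D s -> D t -> Fp (s, t) = t -> Fm (t, s) = s.
Proof. by move=> Ds Dt E; case: (pair_choice Ds Dt) => -[]// <- ->; rewrite E. Qed.

(** The sign condition says that (s, t) and (s', t') lie on the same side of the
   diagonal. *)
Definition constant_choice := forall s t s' t', D s -> D t -> D s' -> D t' ->
  0 < (s - t) * (s' - t') -> Fp (s, t) = s -> Fp (s', t') = s'.

Definition four_maps :=
  [\/ forall f, X f -> T f = f,
        forall f, X f -> T f = dagger u f,
        forall f, X f -> T f = polarization u f |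
        forall f, X f -> T f = dagger u (polarization u f)].

Lemma choice_dichotomy (Q : R -> R -> Prop) : constant_choice ->
  (forall s t s' t', Q s t -> Q s' t' -> 0 < (s - t) * (s' - t')) ->
  (forall s t, D s -> D t -> Q s t -> Fp (s, t) = s) \/
  (forall s t, D s -> D t -> Q s t -> Fp (s, t) = t).
Proof.
move=> cc Qside.
have [[s [t [Ds Dt Qst E]]]|no] :=
    pselect (exists s t, [/\ D s, D t, Q s t & Fp (s, t) = s]).
  by left => s' t' Ds' Dt' Q'; exact: cc Ds Dt Ds' Dt' (Qside _ _ _ _ Qst Q') E.
right => s t Ds Dt Qst; case: (pair_choice Ds Dt) => -[E _] //.
by exfalso; apply: no; exists s, t.
Qed.

Lemma four_maps_of_constant_choice : constant_choice -> four_maps.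
Proof.
move=> cc.
have Tval (gp gm : R -> R -> R) f :
    (forall s t, D s -> D t -> Fp (s, t) = gp s t /\ Fm (t, s) = gm t s) -> X f ->
    forall x, T f x = if 0 <= dot x u then gp (f x) (f (reflection u x))
                      else gm (f x) (f (reflection u x)).
  move=> H Xf x; have Dx := domain_value x Xf.
  have Dx' := domain_value (reflection u x) Xf.
  have [xu|xu] := leP 0 (dot x u); first by rewrite T_pos//; case: (H _ _ Dx Dx').
  by rewrite T_neg ?ltW//; case: (H _ _ Dx' Dx).
have [gt|gt] : (forall s t, D s -> D t -> t < s -> Fp (s, t) = s) \/
  (forall s t, D s -> D t -> t < s -> Fp (s, t) = t).
- by apply: (choice_dichotomy cc) => s t s' t' h h'; rewrite mulr_gt0// subr_gt0.
- have [lt|lt] : (forall s t, D s -> D t -> s < t -> Fp (s, t) = s) \/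
      (forall s t, D s -> D t -> s < t -> Fp (s, t) = t).
  + by apply: (choice_dichotomy cc) => s t s' t' h h'; rewrite nmulr_rgt0 subr_lt0.
  + apply: Or41 => f Xf; apply/funext => x.
    rewrite (@Tval (fun s _ => s) (fun s _ => s))//; first by case: ifP.
    move=> s t Ds Dt; have E : Fp (s, t) = s.
      have [st|ts|<-] := ltgtP s t; [exact: lt|exact: gt|exact: Fp_diag].
    by rewrite (Fm_keep Ds Dt E).
  + apply: Or43 => f Xf; apply/funext => x.
    rewrite (@Tval Num.max Num.min)// => s t Ds Dt.
    have [st|ts|<-] := ltgtP s t.
    * have E := lt _ _ Ds Dt st.
      by rewrite (Fm_swap Ds Dt E) E.
    * have E := gt _ _ Ds Dt ts.
      by rewrite (Fm_keep Ds Dt E) E.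
    * by rewrite -F_diag// Fp_diag.
- have [lt|lt] : (forall s t, D s -> D t -> s < t -> Fp (s, t) = s) \/
      (forall s t, D s -> D t -> s < t -> Fp (s, t) = t).
  + by apply: (choice_dichotomy cc) => s t s' t' h h'; rewrite nmulr_rgt0 subr_lt0.
  + apply: Or44 => f Xf; apply/funext => x.
    rewrite /dagger /polarization dot_reflection// reflectionK// oppr_ge0.
    rewrite (@Tval Num.min Num.max)//; last first.
      move=> s t Ds Dt; have [st|ts|<-] := ltgtP s t.
      * have E := lt _ _ Ds Dt st.
        by rewrite (Fm_keep Ds Dt E) E.
      * have E := gt _ _ Ds Dt ts.
        by rewrite (Fm_swap Ds Dt E) E.
      * by rewrite -F_diag// Fp_diag.
    case: (ltgtP (dot x u) 0) => xu; [by rewrite maxC|by rewrite minC|].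
    by rewrite reflection_fix// maxxx minxx.
  + apply: Or42 => f Xf; apply/funext => x.
    rewrite (@Tval (fun _ t => t) (fun _ t => t))//; first by case: ifP.
    move=> s t Ds Dt; have E : Fp (s, t) = t.
      have [st|ts|<-] := ltgtP s t; [exact: lt|exact: gt|exact: Fp_diag].
    by rewrite (Fm_swap Ds Dt E).
Qed.

Definition locally_constant_choice := forall s t, D s -> D t -> s != t ->
  exists2 e : R, 0 < e & forall s' t', D s' -> D t' ->
    `|s' - s| < e -> `|t' - t| < e -> (Fp (s', t') = s' <-> Fp (s, t) = s).

(** The segment joining two pairs on the same side of the diagonal avoids the
   diagonal, and a locally constant choice is constant along it. *)
Lemma constant_choice_of_local : locally_constant_choice -> constant_choice.
Proof.
move=> lc s t s' t' Ds Dt Ds' Dt' side E; apply: contrapT => E'.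
pose a (l : R) := s + l * (s' - s); pose b (l : R) := t + l * (t' - t).
have D_conv (v w l : R) : 0 <= l <= 1 -> D v -> D w -> D (v + l * (w - v)).
  move=> /andP[l0 l1]; case: k => //= v0 w0.
    by rewrite (_ : _ + _ = (1 - l) * v + l * w); [nra|ring].
  by rewrite (_ : _ + _ = (1 - l) * v + l * w); [nra|ring].
have ab l : 0 <= l <= 1 -> a l != b l.
  move=> /andP[l0 l1]; apply/eqP => eab.
  have h : (1 - l) * (s - t) + l * (s' - t') = 0 by move: eab; rewrite /a /b; lra.
  have p2 : 0 < (s - t) ^+ 2.
    rewrite lt_neqAle sqr_ge0 eq_sym sqrf_eq0 andbT; apply: contraTneq side => ->.
    by rewrite mul0r ltxx.
  have {}h : (1 - l) * (s - t) ^+ 2 + l * ((s - t) * (s' - t')) = 0.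
    by rewrite -(mul0r (s - t)) -h; ring.
  have [l_half|l_half] := leP l 2^-1.
    have := mulr_gt0 (_ : 0 < 1 - l) p2; have := mulr_ge0 l0 (ltW side); lra.
  have := mulr_gt0 (_ : 0 < l) side; have := mulr_ge0 (_ : 0 <= 1 - l) (ltW p2); lra.
(* the choice along the segment, encoded so that the intermediate value theorem
   applies *)
pose e (l : R) : R := if `[< Fp (a l, b l) = a l >] then 1 else -1.
have e_cont : {within `[0, 1], continuous e}.
  apply/subspace_continuousP => l; rewrite /= in_itv/= => l01.
  have Da := D_conv s s' l l01 Ds Ds'; have Db := D_conv t t' l l01 Dt Dt'.
  have [d d0 near_eq] := lc _ _ Da Db (ab l l01).
  pose M := 1 + `|s' - s| + `|t' - t|.
  have M0 : 0 < M by rewrite !ltr_wpDr.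
  apply: cvg_near_cst; rewrite near_withinE.
  near=> m => m01; rewrite /= in_itv/= in m01.
  have lm : `|l - m| < d / M by near: m; apply: cvgr_dist_lt => //; rewrite divr_gt0.
  have close (v w : R) : `|w - v| <= M -> `|v + m * (w - v) - (v + l * (w - v))| < d.
    move=> wM; rewrite (_ : _ - _ = (m - l) * (w - v)); last by ring.
    rewrite normrM distrC; apply: le_lt_trans (ler_wpM2l (normr_ge0 _) wM) _.
    by rewrite -ltr_pdivlMr.
  have := near_eq _ _ (D_conv s s' m m01 Ds Ds') (D_conv t t' m m01 Dt Dt').
  move=> /(_ (close _ _ _) (close _ _ _)) H.
  rewrite /e; congr (if _ then _ else _); apply: asbool_equiv_eq.
  by apply: H; rewrite /M; have := normr_ge0 (s' - s); have := normr_ge0 (t' - t); lra.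
have e0 : e 0 = 1.
  by rewrite /e /a /b !mul0r !addr0 asboolT.
have e1 : e 1 = -1.
  by rewrite /e /a /b !mul1r ![_ + (_ - _)]addrC !subrK asboolF.
have [|l _] := @IVT R e 0 1 0 ler01 e_cont.
  by rewrite e0 e1 ge_min le_max; apply/andP; split; apply/orP; [right|left]; lra.
by rewrite /e; case: ifP => _ h; exfalso; lra.
Unshelve. all: by end_near.
Qed.

(** Keeping and swapping lead to values that differ by about the distance between
   s and t, so a small variation of F+ rules out a change of choice. *)
Lemma same_choice s t s' t' : D s -> D t -> D s' -> D t' -> s != t ->
  `|s' - s| < `|s - t| / 4 -> `|t' - t| < `|s - t| / 4 ->
  `|Fp (s, t) - Fp (s', t')| < `|s - t| / 2 -> (Fp (s', t') = s' <-> Fp (s, t) = s).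
Proof.
move=> Ds Dt Ds' Dt' st s2 t2.
have g0 : 0 < `|s - t| by rewrite normr_gt0 subr_eq0.
have tri1 := ler_distD s' s t; have tri2 := ler_distD t' s t.
rewrite (distrC s s') in tri1; rewrite (distrC s t') in tri2.
have tri3 := ler_distD t' s' t.
case: (pair_choice Ds Dt) => -[E _]; case: (pair_choice Ds' Dt') => -[E' _].
all: rewrite E E' => h.
- by [].
- by exfalso; rewrite (distrC s t') in h; lra.
- by exfalso; rewrite (distrC t s') in h; lra.
- split => [e1|e1]; last by rewrite e1 subrr normr0 ltxx in g0.
  by exfalso; subst t'; lra.
Qed.

Lemma continuous_locally_constant_choice :
  {within D `*` D, continuous Fp} -> locally_constant_choice.
Proof.
move=> /subspace_continuousP cF s t Ds Dt st.
have g0 : 0 < `|s - t| by rewrite normr_gt0 subr_eq0.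
have /cvgrPdist_lt /(_ (`|s - t| / 2)) := cF (s, t) (conj Ds Dt).
rewrite divr_gt0// => /(_ isT); rewrite near_withinE => /nbhs_ballP[e /= e0 sub].
exists (Num.min e (`|s - t| / 4)); first by rewrite lt_min e0 divr_gt0.
move=> s' t' Ds' Dt'; rewrite !lt_min => /andP[s1 s2] /andP[t1 t2].
apply: same_choice => //.
by apply: (sub (s', t') (conj _ _) (conj Ds' Dt')); rewrite /ball/= distrC.
Qed.

Lemma floor_near s t : D s -> D t -> exists c, base_value k c /\
  exists2 e : R, 0 < e & forall s' t', D s' -> D t' ->
    `|s' - s| < e -> `|t' - t| < e -> c <= s' /\ c <= t'.
Proof.
move=> Ds Dt; have [c [ck cs ct floor]] := exists_floor Ds Dt.
exists c; split => //; case: floor => [[cs' ct']|floor]; last first.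
  by exists 1 => // s' t' Ds' Dt' _ _; split; exact: floor.
exists (Num.min (s - c) (t - c)); first by rewrite lt_min !subr_gt0 cs'.
move=> s' t' _ _; rewrite !lt_min !ltr_distl => /andP[/andP[h _] _] /andP[_ /andP[h' _]].
by split; lra.
Qed.

(** In the plane spanned by u and a unit vector w of H, the linear form with
   gradient w + u (or w - u, for the other side of the diagonal) and its mirror
   image are coordinates: the pair of their values sweeps one side of the
   diagonal while the point moves in the open positive half-plane. The continuity
   of T f at a point thus controls F+ near a pair. *)
Lemma continuous_on_tests_locally_constant_choice (w : 'rV[R]_n) :
  dot w u = 0 -> dot w w = 1 ->
  (forall f, test_function k f -> continuous (T f)) -> locally_constant_choice.
Proof.
move=> wu ww Tc s t Ds Dt st.
have g0 : 0 < `|s - t| by rewrite normr_gt0 subr_eq0.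
have [c [ck [e e0 floor]]] := floor_near Ds Dt.
pose sg : R := Num.sg (s - t).
have sg2 : sg * sg = 1 by rewrite -expr2 sqr_sg subr_eq0 st.
have sg_norm : `|sg| = 1 by rewrite normr_sg subr_eq0 st.
have sgE : sg * (s - t) = `|s - t| by rewrite normrEsg.
(* the point where the linear form v takes the value a, and b at its image *)
pose v := sg *: u + w.
pose pt (a b : R) := (sg * (a - b) / 2) *: u + ((a + b) / 2) *: w.
have uu := dot_unit u1.
have pt_v a b : dot (pt a b) v = a.
  rewrite /pt /v !dotE uu ww wu (dotC u w) wu.
  rewrite (_ : _ + _ = sg * sg * (a - b) / 2 + (a + b) / 2); last by ring.
  by rewrite sg2; lra.
have pt_u a b : dot (pt a b) u = sg * (a - b) / 2.
  by rewrite /pt !dotE uu wu; ring.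
have pt_v' a b : dot (reflection u (pt a b)) v = b.
  rewrite /reflection dotBl pt_v dotZl pt_u /v !dotE uu (dotC u w) wu.
  by apply: (@etrans _ _ (a - sg * sg * (a - b))); [field|rewrite sg2; lra].
have w1 : enorm w = 1 by rewrite /enorm ww sqrtr1.
have pt_norm a b : enorm (pt a b) <= `|a| + `|b|.
  apply: le_trans (ler_enormD _ _) _; rewrite !enormZ u1 w1 !mulr1 !normrM.
  rewrite sg_norm mul1r normfV (ger0_norm (_ : 0 <= 2))//.
  by have := ler_normB a b; have := ler_normD a b; lra.
have ptB a b a' b' : pt a b - pt a' b' = pt (a - a') (b - b').
  apply/rowP => i; rewrite /pt !mxE; ring.
pose B : R := `|s| + `|t| + 2.
have [f tf f_lin] := @test_function_linear R n k v c B ck.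
have Xf := test_function_in_space tf.
have /cvgrPdist_lt /(_ (`|s - t| / 2)) := Tc f tf (pt s t).
rewrite divr_gt0// => /(_ isT)/nbhs_ballP[d /= d0 sub].
exists (Num.min (Num.min e 1) (Num.min (`|s - t| / 4) (d / 2))).
  by rewrite !lt_min e0 ltr01 !divr_gt0.
have value s' t' : D s' -> D t' -> `|s' - s| < e -> `|t' - t| < e ->
    `|s' - s| < 1 -> `|t' - t| < 1 -> `|s' - s| < `|s - t| / 4 ->
    `|t' - t| < `|s - t| / 4 -> T f (pt s' t') = Fp (s', t').
  move=> Ds' Dt' s1 t1 s2 t2 s3 t3; have [cs ct] := floor s' t' Ds' Dt' s1 t1.
  have s'B : `|s'| < `|s| + 1 by have := lerB_dist s' s; lra.
  have t'B : `|t'| < `|t| + 1 by have := lerB_dist t' t; lra.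
  have nB : enorm (pt s' t') <= B by apply: le_trans (pt_norm _ _) _; rewrite /B; lra.
  rewrite T_pos//.
    rewrite !f_lin ?pt_v ?pt_v' ?enorm_reflection//.
      by apply: le_trans (ler_norm _) _; rewrite /B; have := normr_ge0 s; lra.
    by apply: le_trans (ler_norm _) _; rewrite /B; have := normr_ge0 t; lra.
  rewrite pt_u (_ : s' - t' = (s - t) + ((s' - s) - (t' - t))); last by ring.
  rewrite mulrDr sgE; have := ler_norm (- (sg * (s' - s - (t' - t)))).
  by rewrite normrN normrM sg_norm mul1r; have := ler_normB (s' - s) (t' - t); lra.
move=> s' t' Ds' Dt'; rewrite !lt_min => /andP[/andP[s1 s2] /andP[s3 s4]].
move=> /andP[/andP[t1 t2] /andP[t3 t4]]; apply: same_choice => //.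
rewrite -!value// ?subrr ?normr0 ?divr_gt0//.
apply: sub; split => // i j; rewrite /ball/= ord1.
have := norm_coord_le (pt s t - pt s' t') j; rewrite !mxE => h.
apply: le_lt_trans h _; rewrite ptB; apply: le_lt_trans (pt_norm _ _) _.
by rewrite distrC (distrC t); lra.
Qed.

Lemma ae_exists (Q : 'rV[R]_n -> Prop) (B : set 'rV[R]_n) :
  (\forall x \ae (@leb R n), Q x) -> measurable (B : set (lebRn R n)) ->
  (0 < leb (B : set (lebRn R n)))%E -> exists2 x, B x & Q x.
Proof.
move=> [N [mN N0 QN]] mB B0; apply: contrapT => no.
move: B0; apply/negP; rewrite -leNgt -N0; apply: le_measure; rewrite ?inE//.
by move=> x Bx; apply: QN => Qx; apply: no; exists x.
Qed.

Lemma monotonic_F s t s' t' : monotonic X T -> D s -> D t -> D s' -> D t' ->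
  s <= s' -> t <= t' -> Fp (s, t) <= Fp (s', t') /\ Fm (t, s) <= Fm (t', s').
Proof.
move=> mono Ds Dt Ds' Dt' ss tt; have [c [ck cs ct _]] := exists_floor Ds Dt.
have cs' := le_trans cs ss; have ct' := le_trans ct tt.
have le_tv x : tv c s t x <= tv c s' t' x.
  by rewrite lerD2l lerD// ler_wpM2r// lerB.
have := mono _ _ (tv_in_space ck cs ct) (tv_in_space ck cs' ct').
have le_tv_ae : \forall x \ae (@leb R n), tv c s t x <= tv c s' t' x by exact: aeW.
move=> /(_ le_tv_ae); rewrite !T_two_valued// => le_ae; split.
  have [|x xP] := ae_exists le_ae (measurable_plus_ball u); last by rewrite !two_valued_plus.
  by apply: leb_eball_gt0; lra.
have [|x xN] := ae_exists le_ae (measurable_minus_ball u); last by rewrite !two_valued_minus.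
by apply: leb_eball_gt0; lra.
Qed.

(** A choice made at (s, t) propagates to every pair with a larger gap around
   [t, s]; two such quadrants always meet, so all choices agree. *)
Lemma monotonic_constant_choice : monotonic X T -> constant_choice.
Proof.
move=> mono s t s' t' Ds Dt Ds' Dt' side E.
case: (pair_choice Ds' Dt') => -[// E' F']; exfalso.
have F := Fm_keep Ds Dt E.
have M a b a' b' := @monotonic_F a b a' b' mono.
have D2 a b : D a -> D b -> D (Num.max a b) /\ D (Num.min a b).
  by case: (leP a b).
have [DS Dm] := D2 _ _ Ds Ds'; have [DM Dn] := D2 _ _ Dt Dt'.
have [st|ts|st] := ltgtP s t; last by rewrite st subrr mul0r ltxx in side.
- have st' : s' < t' by rewrite nmulr_rgt0 subr_lt0// in side.
  set S := Num.min s s' in Dm; set N := Num.max t t' in DM.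
  have Ss : S <= s by rewrite ge_min lexx.
  have Ss' : S <= s' by rewrite ge_min lexx orbT.
  have tN : t <= N by rewrite le_max lexx.
  have tN' : t' <= N by rewrite le_max lexx orbT.
  have [h1 _] := M S t s t Dm Dt Ds Dt Ss (lexx _); rewrite E in h1.
  case: (pair_choice Dm Dt) => -[E1 F1]; last by lra.
  have [_ h2] := M S t S N Dm Dt Dm DM (lexx _) tN; rewrite F1 in h2.
  case: (pair_choice Dm DM) => -[E2 F2]; last by lra.
  have [h3 _] := M s' t' s' N Ds' Dt' Ds' DM (lexx _) tN'; rewrite E' in h3.
  case: (pair_choice Ds' DM) => -[E3 F3]; first by lra.
  have [_ h4] := M S N s' N Dm DM Ds' DM Ss' (lexx _); lra.
- have ts' : t' < s' by rewrite pmulr_rgt0 subr_gt0// in side.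
  set S := Num.max s s' in DS; set N := Num.min t t' in Dn.
  have Ss : s <= S by rewrite le_max lexx.
  have Ss' : s' <= S by rewrite le_max lexx orbT.
  have tN : N <= t by rewrite ge_min lexx.
  have tN' : N <= t' by rewrite ge_min lexx orbT.
  have [h1 _] := M s t S t Ds Dt DS Dt Ss (lexx _); rewrite E in h1.
  case: (pair_choice DS Dt) => -[E1 F1]; last by lra.
  have [_ h2] := M S N S t DS Dn DS Dt (lexx _) tN; rewrite F1 in h2.
  case: (pair_choice DS Dn) => -[E2 F2]; last by lra.
  have [h3 _] := M s' N s' t' Ds' Dn Ds' Dt' (lexx _) tN'; rewrite E' in h3.
  case: (pair_choice Ds' Dn) => -[E3 F3]; first by lra.
  have [_ h4] := M s' N S N Ds' Dn DS Dn Ss' (lexx _); lra.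
Qed.

(** ** Contraction of an Lp norm *)

Lemma two_valuedB c s t s' t' x :
  tv c s t x - tv c s' t' x = (s - s') * \1_(plus_ball u) x + (t - t') * \1_(minus_ball u) x.
Proof. by rewrite /two_valued; ring. Qed.

Definition both_balls : set 'rV[R]_n := plus_ball u `|` minus_ball u.

Lemma measurable_both_balls : measurable (both_balls : set (lebRn R n)).
Proof. by apply: measurableU; [exact: measurable_plus_ball|exact: measurable_minus_ball]. Qed.

Lemma norm_two_valuedB_le c s t s' t' (e : R) x : `|s - s'| <= e -> `|t - t'| <= e ->
  `|tv c s t x - tv c s' t' x| <= `|e * \1_both_balls x|.
Proof.
move=> es et; have e0 : 0 <= e by apply: le_trans es.
rewrite two_valuedB !indicE in_setU.
have [/set_mem xP|xP] := boolP (x \in plus_ball u).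
  rewrite memNset => [|xN]; last by have : set0 x by rewrite -(plus_minus_disjoint u1).
  by rewrite orbF !mulr1 mulr0 addr0 (ger0_norm e0).
have [xN|xN] := boolP (x \in minus_ball u); first by rewrite !mulr1 mulr0 add0r (ger0_norm e0).
by rewrite !mulr0 addr0 normr0.
Qed.

Lemma norm_two_valuedB_ge c s t s' t' (e : R) x : 0 <= e -> e <= `|s - s'| -> e <= `|t - t'| ->
  `|e * \1_both_balls x| <= `|tv c s t x - tv c s' t' x|.
Proof.
move=> e0 es et; rewrite two_valuedB !indicE in_setU.
have [/set_mem xP|xP] := boolP (x \in plus_ball u).
  rewrite memNset => [|xN]; last by have : set0 x by rewrite -(plus_minus_disjoint u1).
  by rewrite orbF !mulr1 mulr0 addr0 (ger0_norm e0).
have [xN|xN] := boolP (x \in minus_ball u); first by rewrite !mulr1 mulr0 add0r (ger0_norm e0).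
by rewrite !mulr0 normr0.
Qed.

(** Different choices at nearby pairs put the values of T far apart, on both
   balls at once. *)
Lemma choice_gap s t s' t' : D s -> D t -> D s' -> D t' ->
  `|s' - s| < `|s - t| / 4 -> `|t' - t| < `|s - t| / 4 ->
  ~ (Fp (s', t') = s' <-> Fp (s, t) = s) ->
  `|s - t| / 2 <= `|Fp (s, t) - Fp (s', t')| /\
  `|s - t| / 2 <= `|Fm (t, s) - Fm (t', s')|.
Proof.
move=> Ds Dt Ds' Dt' s2 t2.
have tri1 := ler_distD s' s t; have tri2 := ler_distD t' s t.
rewrite (distrC s s') in tri1; rewrite (distrC s t') in tri2.
have g0 := normr_ge0 (s - t).
case: (pair_choice Ds Dt) => -[E E1]; case: (pair_choice Ds' Dt') => -[E' E1'].
all: rewrite E E' E1 E1' => h.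
- by exfalso; apply: h.
- by rewrite (distrC s t') (distrC t s'); split; lra.
- by rewrite (distrC s t') (distrC t s'); split; lra.
- exfalso; apply: h; split => [e1|e1].
    by subst t'; exfalso; lra.
  by subst t; rewrite subrr normr0 in s2 t2; have := normr_ge0 (s' - s); lra.
Qed.

(** If the choices at two nearby pairs differed, two two-valued functions at small
   distance would have images at large distance. *)
Lemma Lp_contracting_locally_constant_choice (p : \bar R) : (1 <= p)%E ->
  (forall f, X f -> X (T f)) -> Lp_contracting X p T -> locally_constant_choice.
Proof.
move=> p1 TX contr s t Ds Dt st.
have g0 : 0 < `|s - t| by rewrite normr_gt0 subr_eq0.
have [c [ck [e e0 floor]]] := floor_near Ds Dt.
exists (Num.min e (`|s - t| / 4)); first by rewrite lt_min e0 divr_gt0.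
move=> s' t' Ds' Dt'; rewrite !lt_min => /andP[s1 s2] /andP[t1 t2].
apply: contrapT => /(choice_gap Ds Dt Ds' Dt' s2 t2)[gapP gapN].
have [cs' ct'] := floor _ _ Ds' Dt' s1 t1.
have [cs ct] : c <= s /\ c <= t by apply: floor; rewrite ?subrr ?normr0.
have Xf := tv_in_space ck cs ct; have Xf' := tv_in_space ck cs' ct'.
have mB (f g : 'rV[R]_n -> R) : X f -> X g ->
    measurable_fun setT ((f \- g) : lebRn R n -> R).
  by move=> Xf1 Xg1; apply: measurable_funB; exact: (@measurable_of_space _ _ k).
have mA := measurable_both_balls.
have mI (a : R) : measurable_fun setT ((fun x => a * \1_both_balls x) : lebRn R n -> R).
  by apply: measurable_funM; [exact: measurable_cst|exact: measurable_indic].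
have A0 : (0 < leb (both_balls : set (lebRn R n)))%E.
  apply: (@lt_le_trans _ _ (leb (plus_ball u : set (lebRn R n)))).
    by apply: leb_eball_gt0; lra.
  by apply: leb_outer_homo => x; left.
have Ay : (leb (both_balls : set (lebRn R n)) < +oo)%E.
  apply: le_lt_trans (lte_add_pinfty (leb_eball_lty u 2^-1) (leb_eball_lty (- u) 2^-1)).
  by apply: measureU2; [exact: measurable_plus_ball|exact: measurable_minus_ball].
have [m m0 normE] := Lnorm_indic p1 mA A0 Ay.
have low : ('N[@leb R n]_p[EFin \o (tv c s t \- tv c s' t')%R] <=
    (`|s - t| / 4 * m)%:E)%E.
  rewrite -normE ?divr_ge0//; apply: Lnorm_le; [exact: p1|exact: mB|exact: mI|].
  by move=> x; apply: norm_two_valuedB_le; rewrite distrC ltW.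
have fL : ((tv c s t \- tv c s' t')%R : lebRn R n -> R) \in Lfun (@leb R n) p.
  rewrite inE; apply/andP; split; rewrite inE/=; first exact: mB.
  by rewrite /finite_norm; apply: le_lt_trans low _; rewrite ltry.
have := le_trans (contr _ _ Xf Xf' fL) low.
apply/negP; rewrite -ltNge.
apply: (@lt_le_trans _ _ (`|s - t| / 2 * m)%:E).
  by rewrite lte_fin ltr_pM2r//; lra.
rewrite -normE ?divr_ge0//; apply: Lnorm_le; [exact: p1|exact: mI|by apply: mB; exact: TX|].
by move=> x; rewrite /= !T_two_valued//; apply: norm_two_valuedB_ge.
Qed.

(** ** Reduction of the modulus of continuity *)

Definition plateau (p x : 'rV[R]_n) : R :=
  Num.max 0 (Num.min 1 (2 - 4 * enorm (x - p))).

Lemma plateau_ge0 p x : 0 <= plateau p x.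
Proof. by rewrite le_max lexx. Qed.

Lemma plateau_in p x : eball p 4^-1 x -> plateau p x = 1.
Proof.
rewrite /eball/= /plateau => xp; rewrite min_l; last by lra.
by rewrite max_r.
Qed.

Lemma plateau_out p x : ~ eball p 2^-1 x -> plateau p x = 0.
Proof.
rewrite /eball/= /plateau => /negP; rewrite -ltNge => xp.
by apply: max_l; rewrite ge_min; apply/orP; right; lra.
Qed.

Lemma plateau_lipschitz p x y : `|plateau p x - plateau p y| <= 4 * enorm (x - y).
Proof.
have h : `|enorm (x - p) - enorm (y - p)| <= enorm (x - y).
  by have := ler_dist_enorm (x - p) (y - p); rewrite opprB addrA subrK.
have clamp (z : R) : [\/ z <= 0 /\ Num.max 0 (Num.min 1 z) = 0,
    [/\ 0 <= z, z <= 1 & Num.max 0 (Num.min 1 z) = z] |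
    1 <= z /\ Num.max 0 (Num.min 1 z) = 1].
  have [z1|z1] := leP 1 z; first by apply: Or33; rewrite max_r.
  have [z0|z0] := leP z 0; first by apply: Or31.
  by apply: Or32; split => //; exact: ltW.
rewrite /plateau; move: h; set a := enorm (x - p); set b := enorm (y - p).
set e := enorm (x - y); rewrite !ler_norml => /andP[h1 h2].
by case: (clamp (2 - 4 * a)) => [[? ->]|[? ? ->]|[? ->]];
  case: (clamp (2 - 4 * b)) => [[? ->]|[? ? ->]|[? ->]]; apply/andP; split; lra.
Qed.

Lemma measurable_plateau p : measurable_fun setT (plateau p : lebRn R n -> R).
Proof.
apply: measurable_maxr; first exact: measurable_cst.
apply: measurable_minr; first exact: measurable_cst.
apply: measurable_funB; first exact: measurable_cst.
by apply: measurable_funM; [exact: measurable_cst|exact: measurable_enormB].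
Qed.

Lemma plateau_mirror x : plateau u (reflection u x) = plateau (- u) x.
Proof. by rewrite /plateau enorm_reflectionB// reflection_unit. Qed.

(** A Lipschitz function up to a jump as small as s' - s and t' - t, which takes
   the values (s, t) and (s', t') at mirror points on adjacent sets of positive
   measure. *)
Definition stepped_plateau c s t s' t' x : R :=
  c + ((s - c) * plateau u x + (s' - s) * \1_[set x | eball u 4^-1 x /\ 1 < dot x u] x +
       ((t - c) * plateau (- u) x +
        (t' - t) * \1_[set x | eball (- u) 4^-1 x /\ dot x u < - 1] x)).

Local Notation Q := [set x | eball u 4^-1 x /\ 1 < dot x u].
Local Notation Q' := [set x | eball (- u) 4^-1 x /\ dot x u < - 1].

Lemma far_part_mirror x : Q (reflection u x) <-> Q' x.
Proof.
rewrite /= dot_reflection//; split=> -[h1 h2]; split; try lra.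
  exact/eball_mirror.
exact/(eball_mirror u1).
Qed.

Lemma small_ball_plus p x : eball p 4^-1 x -> eball p 2^-1 x.
Proof. by rewrite /eball/=; lra. Qed.

Lemma stepped_plateau_mirror c s t s' t' x :
  stepped_plateau c s t s' t' (reflection u x) = stepped_plateau c t s t' s' x.
Proof.
have m1 : \1_Q (reflection u x) = \1_Q' x :> R.
  rewrite !indicE; congr (nat_of_bool _)%:R.
  by apply/idP/idP => /set_mem/far_part_mirror/mem_set.
have m2 : \1_Q' (reflection u x) = \1_Q x :> R.
  rewrite !indicE; congr (nat_of_bool _)%:R.
  apply/idP/idP => /set_mem h; apply/mem_set.
    by rewrite -(reflectionK u1 x); apply/far_part_mirror.
  by apply/far_part_mirror; rewrite reflectionK.
rewrite /stepped_plateau m1 m2 plateau_mirror -(plateau_mirror (reflection u x)).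
by rewrite reflectionK//; ring.
Qed.

Lemma stepped_plateau_in_space c s t s' t' : base_value k c -> c <= s -> c <= t ->
  c <= s' -> c <= t' -> X (stepped_plateau c s t s' t').
Proof.
move=> ck cs ct cs' ct'.
have mQ : measurable (Q : set (lebRn R n)).
  rewrite (_ : Q = eball u 4^-1 `&` ([set: lebRn R n] `&`
      (fun x : lebRn R n => dot (x : 'rV[R]_n) u) @^-1` `]1, +oo[)).
    apply: measurableI; first exact: measurable_eball.
    by apply: measurable_dot => //; exact: measurable_itv.
  by rewrite setTI; apply/seteqP; split => x /=; rewrite in_itv/= andbT.
have mQ' : measurable (Q' : set (lebRn R n)).
  rewrite (_ : Q' = eball (- u) 4^-1 `&` ([set: lebRn R n] `&`
      (fun x : lebRn R n => dot (x : 'rV[R]_n) u) @^-1` `]-oo, -1[)).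
    apply: measurableI; first exact: measurable_eball.
    by apply: measurable_dot => //; exact: measurable_itv.
  by rewrite setTI; apply/seteqP; split => x /=; rewrite in_itv/=.
have half_ge0 p (S : set 'rV[R]_n) (a b : R) x :
    (forall x, S x -> eball p 4^-1 x) -> c <= a -> c <= b ->
    0 <= (a - c) * plateau p x + (b - a) * \1_S x.
  move=> Sp ca cb; rewrite indicE; case: (boolP (x \in S)) => [/set_mem/Sp xp|_].
    by rewrite plateau_in// !mulr1; lra.
  by rewrite mulr0 addr0 mulr_ge0 ?plateau_ge0// subr_ge0.
have half_eq0 p (S : set 'rV[R]_n) (a b : R) x : (forall x, S x -> eball p 4^-1 x) ->
    ~ eball p 2^-1 x -> (a - c) * plateau p x + (b - a) * \1_S x = 0.
  move=> Sp xp; rewrite plateau_out// indicE memNset ?mulr0 ?addr0//.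
  by move=> /Sp/small_ball_plus.
apply: (@base_add_in_space _ _ _ _ _ both_balls); first exact: ck.
- apply: measurable_funD; apply: measurable_funD; apply: measurable_funM.
  + exact: measurable_cst.
  + exact: measurable_plateau.
  + exact: measurable_cst.
  + exact: measurable_indic.
  + exact: measurable_cst.
  + exact: measurable_plateau.
  + exact: measurable_cst.
  + exact: measurable_indic.
- by move=> x; apply: addr_ge0; apply: half_ge0 => // y [].
- move=> x /not_orP[xP xN]; rewrite !half_eq0 ?addr0//.
  + by move=> y [].
  + by move=> y [].
- apply: le_lt_trans (lte_add_pinfty (leb_eball_lty u 2^-1) (leb_eball_lty (- u) 2^-1)).
  by apply: measureU2; [exact: measurable_plus_ball|exact: measurable_minus_ball].
Qed.

Lemma stepped_plateau_val c s t s' t' x : eball u 4^-1 x ->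
  stepped_plateau c s t s' t' x = if 1 < dot x u then s' else s.
Proof.
move=> xu; have x0 := plus_ball_pos u1 (small_ball_plus xu).
have xN : ~ eball (- u) 2^-1 x by move=> /(minus_ball_neg u1); lra.
rewrite /stepped_plateau plateau_in// (plateau_out xN) !indicE.
rewrite [_ \in Q'](memNset _); last by move=> [/small_ball_plus].
case: ifP => h; first by rewrite mem_set// !mulr1 !mulr0; lra.
by rewrite memNset ?mulr1 ?mulr0; [lra|case; rewrite h].
Qed.

Lemma stepped_plateau_dist c s t s' t' (e : R) x y : `|s' - s| <= e -> `|t' - t| <= e ->
  `|stepped_plateau c s t s' t' x - stepped_plateau c s t s' t' y| <=
  4 * (`|s - c| + `|t - c|) * enorm (x - y) + 4 * e.
Proof.
move=> se te.
have ind (S : set 'rV[R]_n) : `|\1_S x - \1_S y : R| <= 1.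
  rewrite !indicE; case: (x \in S); case: (y \in S) => /=;
    by rewrite ?subrr ?subr0 ?sub0r ?normrN ?normr0 ?normr1.
have e0 : 0 <= e by apply: le_trans se.
rewrite /stepped_plateau (_ : _ - _ =
  (s - c) * (plateau u x - plateau u y) + (t - c) * (plateau (- u) x - plateau (- u) y) +
  ((s' - s) * (\1_Q x - \1_Q y) + (t' - t) * (\1_Q' x - \1_Q' y))); last by ring.
have h1 := ler_wpM2l (normr_ge0 (s - c)) (plateau_lipschitz u x y).
have h2 := ler_wpM2l (normr_ge0 (t - c)) (plateau_lipschitz (- u) x y).
have h3 := ler_pM (normr_ge0 _) (normr_ge0 _) se (ind Q).
have h4 := ler_pM (normr_ge0 _) (normr_ge0 _) te (ind Q').
rewrite -!normrM in h1 h2 h3 h4.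
apply: le_trans (ler_normD _ _) _; apply: le_trans (lerD (ler_normD _ _) (ler_normD _ _)) _.
lra.
Qed.

(** If the choices at (s, t) and (s', t') differed, the image of a stepped plateau
   would jump by about the distance between s and t across the step, on arbitrarily
   close sets of positive measure, although the stepped plateau itself varies
   little at small distances. *)
Lemma reduces_modulus_locally_constant_choice :
  reduces_modulus_of_continuity X T -> locally_constant_choice.
Proof.
move=> red s t Ds Dt st.
have g0 : 0 < `|s - t| by rewrite normr_gt0 subr_eq0.
have [c [ck [e e0 floor]]] := floor_near Ds Dt.
exists (Num.min e (`|s - t| / 32)); first by rewrite lt_min e0 divr_gt0.
move=> s' t' Ds' Dt'; rewrite !lt_min => /andP[s1 s2] /andP[t1 t2].
apply: contrapT => /(choice_gap Ds Dt Ds' Dt')[||gap _]; [lra|lra|].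
have [cs' ct'] := floor _ _ Ds' Dt' s1 t1.
have [cs ct] : c <= s /\ c <= t by apply: floor; rewrite ?subrr ?normr0.
pose f := stepped_plateau c s t s' t'.
have Xf : X f by exact: stepped_plateau_in_space.
pose L := 4 * (`|s - c| + `|t - c|).
have L0 : 0 <= L by rewrite mulr_ge0// addr_ge0.
(* at this distance the plateaus vary by at most an eighth of the gap *)
pose d := `|s - t| / (8 * (L + 1)).
have d0 : 0 < d by rewrite divr_gt0// mulr_gt0//; lra.
have Ld : L * d <= `|s - t| / 8.
  rewrite /d invfM !mulrA ler_pdivrMr; last by lra.
  lra.
have fmod : (modulus_of_continuity d f <= (`|s - t| / 4)%:E)%E.
  apply: ereal_inf_lbound => /=; apply: aeW => z zd; rewrite lee_fin.
  apply: le_trans (stepped_plateau_dist _ _ _ (ltW s2) (ltW t2)) _.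
  by have := ler_wpM2l L0 zd; rewrite -/L; lra.
have : (modulus_of_continuity d (T f) < (`|s - t| / 2)%:E)%E.
  by apply: le_lt_trans (red f Xf d d0) _; apply: le_lt_trans fmod _; rewrite lte_fin; lra.
move=> /ereal_inf_lt[y /= [N [mN N0 Nsub]] yg].
pose r := Num.min (d / 3) 8^-1.
have r0 : 0 < r by rewrite lt_min divr_gt0//; lra.
have rd : r <= d / 3 by rewrite ge_min lexx.
have r8 : r <= 8^-1 by rewrite ge_min lexx orbT.
(* two balls on the two sides of the step, at distance at most d *)
pose A := eball (u + r *: u) (r / 2); pose B := eball (u - r *: u) (r / 2).
have uu := dot_unit u1.
have near_u (a : R) x : `|a| = r -> eball (u + a *: u) (r / 2) x ->
    eball u 4^-1 x /\ `|dot x u - (1 + a)| <= r / 2.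
  move=> ar; rewrite /eball/= => xr; split.
    rewrite (_ : x - u = (x - (u + a *: u)) + a *: u).
      by apply: le_trans (ler_enormD _ _) _; rewrite enormZ u1 ar; lra.
    by rewrite opprD addrA subrK.
  rewrite (_ : _ - _ = dot (x - (u + a *: u)) u); last by rewrite !dotE uu; ring.
  by apply: le_trans (cauchy_schwarz _ _) _; rewrite u1 mulr1.
have inA x : A x -> T f x = Fp (s', t').
  move=> /(near_u _ _ (gtr0_norm r0))[xu]; rewrite ler_norml => /andP[h _].
  rewrite T_pos//; last by lra.
  have x1 : 1 < dot x u by lra.
  by rewrite /f stepped_plateau_mirror// !stepped_plateau_val// x1.
have inB x : B x -> T f x = Fp (s, t).
  rewrite /B -scaleNr; have rN : `|- r| = r by rewrite normrN gtr0_norm.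
  move=> /(near_u _ _ rN)[xu]; rewrite ler_norml => /andP[h1 h2].
  rewrite T_pos//; last by lra.
  have x1 : dot x u <= 1 by lra.
  by rewrite /f stepped_plateau_mirror// !stepped_plateau_val// ltNge x1.
have AB x z : A x -> B z -> enorm (x - z) <= d.
  rewrite /A /B /eball/= => xA zB.
  rewrite (_ : x - z = (x - (u + r *: u)) + (r + r) *: u - (z - (u - r *: u))).
    apply: le_trans (ler_enormD _ _) _; rewrite enormN.
    have := ler_enormD (x - (u + r *: u)) ((r + r) *: u).
    by rewrite enormZ u1 mulr1 gtr0_norm ?addr_gt0//; lra.
  by apply/rowP => i; rewrite !mxE; ring.
have mA : measurable (A : set (lebRn R n)) by exact: measurable_eball.
have mB : measurable (B : set (lebRn R n)) by exact: measurable_eball.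
suff : (0 < (@leb R n \x @leb R n) (A `*` B))%E.
  apply/negP; rewrite -leNgt -N0; apply: le_measure; rewrite ?inE//.
    by apply: measurableX; [exact: mA|exact: mB].
  move=> [x z] [/= xA zB]; apply: Nsub => /= /(_ (AB x z xA zB)).
  rewrite inA// inB// distrC => h.
  have := le_lt_trans h yg; rewrite lte_fin; lra.
rewrite product_measure1E; [|exact: mA|exact: mB].
by apply: mule_gt0; apply: leb_eball_gt0; exact: divr_gt0.
Qed.
Lemma attained_pair s t : D s -> D t -> exists f,
  [/\ X f, f u = s, f (- u) = t, T f u = Fp (s, t) & T f (- u) = Fm (t, s)].
Proof.
move=> Ds Dt; have [c [ck cs ct _]] := exists_floor Ds Dt.
have uP := center_plus_ball u; have uN := center_minus_ball u.
exists (tv c s t); split; first exact: tv_in_space.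
- by rewrite two_valued_plus.
- by rewrite two_valued_minus.
- by rewrite T_two_valued// two_valued_plus.
- by rewrite T_two_valued// two_valued_minus.
Qed.

Lemma within_continuous (F G : R * R -> R) : continuous G ->
  (forall s t, D s -> D t -> F (s, t) = G (s, t)) -> {within D `*` D, continuous F}.
Proof.
move=> cG FG; apply: (@subspace_eq_continuous _ _ _ G).
  by move=> [s t] /set_mem[/= Ds Dt]; exact/esym/FG.
exact: continuous_subspaceT.
Qed.

(** Every pair of values is attained at u and - u, so T determines F+ and F-. *)
Lemma four_maps_continuous : four_maps ->
  {within D `*` D, continuous Fp} /\ {within D `*` D, continuous Fm}.
Proof.
have c1 : continuous (fun z : R * R => z.1) by move=> z; exact: cvg_fst.
have c2 : continuous (fun z : R * R => z.2) by move=> z; exact: cvg_snd.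
have uu := dot_unit u1.
have pol (f : 'rV[R]_n -> R) : polarization u f u = Num.max (f u) (f (- u)) /\
    polarization u f (- u) = Num.min (f (- u)) (f u).
  rewrite /polarization dotNl uu ler01 lerNr oppr0 lt_geF//.
  have ru := reflection_unit u1.
  by rewrite -{3}ru reflectionK// ru.
have dag (f : 'rV[R]_n -> R) : dagger u f u = f (- u) /\ dagger u f (- u) = f u.
  by rewrite /dagger -[in f (reflection u (- u))](reflection_unit u1) reflectionK// reflection_unit.
case=> TE; split.
- apply: (within_continuous c1) => s t Ds Dt.
  by have [f [Xf fu fu' <- _]] := attained_pair Ds Dt; rewrite TE.
- apply: (within_continuous c1) => s t Ds Dt.
  by have [f [Xf fu fu' _ <-]] := attained_pair Dt Ds; rewrite TE.
- apply: (within_continuous c2) => s t Ds Dt.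
  by have [f [Xf fu fu' <- _]] := attained_pair Ds Dt; rewrite TE// (dag f).1.
- apply: (within_continuous c2) => s t Ds Dt.
  by have [f [Xf fu fu' _ <-]] := attained_pair Dt Ds; rewrite TE// (dag f).2.
- apply: (within_continuous (continuous_maxr c1 c2)) => s t Ds Dt.
  by have [f [Xf fu fu' <- _]] := attained_pair Ds Dt; rewrite TE// (pol f).1 fu fu'.
- apply: (within_continuous (continuous_minr c1 c2)) => s t Ds Dt.
  by have [f [Xf fu fu' _ <-]] := attained_pair Dt Ds; rewrite TE// (pol f).2 fu fu'.
- apply: (within_continuous (continuous_minr c1 c2)) => s t Ds Dt.
  have [f [Xf fu fu' <- _]] := attained_pair Ds Dt.
  by rewrite TE// (dag _).1 (pol f).2 fu fu' minC.
- apply: (within_continuous (continuous_maxr c1 c2)) => s t Ds Dt.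
  have [f [Xf fu fu' _ <-]] := attained_pair Dt Ds.
  by rewrite TE// (dag _).2 (pol f).1 fu fu' maxC.
Qed.
End pointwise_equimeasurable.

(** * Invariance of Lebesgue measure under the reflection *)

Section reflection_invariance.
Context (R : realType) (n : nat) (v : 'rV[R]_n) (v1 : enorm v = 1).
Context (k : space_kind) (T : ('rV[R]_n -> R) -> 'rV[R]_n -> R).
Local Notation X := (@function_space R n k).
Local Notation rho := (reflection v).
Context (TX : forall f, X f -> X (T f)) (T_equimeasurable : equimeasurable X T).
Implicit Types (A B : set 'rV[R]_n).

Definition invariant_set A := measurable (rho @^-1` A : set (lebRn R n)) /\
  leb (rho @^-1` A : set (lebRn R n)) = leb (A : set (lebRn R n)).

Definition reflection_invariant := forall A,
  measurable (A : set (lebRn R n)) -> invariant_set A.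

Lemma base_value0 : base_value k (0 : R). Proof. by case: k. Qed.

Lemma indic_in_space A : measurable (A : set (lebRn R n)) ->
  (leb (A : set (lebRn R n)) < +oo)%E -> X (\1_A).
Proof.
move=> mA Ay; rewrite (_ : \1_A = (fun x => 0 + \1_A x)).
  apply: (base_add_in_space base_value0 _ _ _ Ay); [exact: measurable_indic|by []|].
  by move=> x xA; rewrite indicE memNset.
by apply/funext => x; rewrite add0r.
Qed.

Lemma T_indic A B : measurable (A : set (lebRn R n)) ->
  (leb (A : set (lebRn R n)) < +oo)%E -> T (\1_A) = \1_B ->
  measurable (B : set (lebRn R n)) /\
  leb (B : set (lebRn R n)) = leb (A : set (lebRn R n)).
Proof.
move=> mA Ay TB; have XA := indic_in_space mA Ay; split.
  by have := measurable_of_space (TX XA); rewrite TB => /measurable_indicP.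
have := T_equimeasurable XA 0; rewrite TB.
have superE (C : set 'rV[R]_n) : superlevel (\1_C) 0 = C :> set 'rV[R]_n.
  apply/seteqP; split => x; rewrite /superlevel/= indicE.
    by case: (boolP (x \in C)) => [/set_mem//|_]; rewrite ltxx.
  by move=> xC; rewrite mem_set.
by rewrite !superE.
Qed.

Lemma invariant_setU A B : measurable (A : set (lebRn R n)) ->
  measurable (B : set (lebRn R n)) -> A `&` B = set0 ->
  invariant_set A -> invariant_set B -> invariant_set (A `|` B).
Proof.
move=> mA mB AB [mA' eA] [mB' eB]; rewrite /invariant_set preimage_setU; split.
  exact: measurableU.
rewrite measureU//; last by rewrite -preimage_setI AB preimage_set0.
by rewrite [RHS]measureU//; congr (_ + _)%E; [exact: eA|exact: eB].
Qed.

(** The shells cut an arbitrary set into countably many bounded pieces. *)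
Definition shell (j : nat) : set 'rV[R]_n :=
  [set x | j%:R <= enorm x < j.+1%:R].

Lemma measurable_shell j : measurable (shell j : set (lebRn R n)).
Proof.
rewrite (_ : shell j = [set: lebRn R n] `&`
    (fun x : lebRn R n => enorm ((x : 'rV[R]_n) - 0)) @^-1` `[j%:R, j.+1%:R[).
  by apply: measurable_enormB => //; exact: measurable_itv.
by rewrite setTI; apply/seteqP; split => x /=; rewrite in_itv/= subr0.
Qed.

Lemma trivIset_shell : trivIset setT shell.
Proof.
apply/trivIsetP => i j _ _ ij; apply/seteqP; split => // x [/= /andP[i1 i2] /andP[j1 j2]].
have := le_lt_trans i1 j2; have := le_lt_trans j1 i2; rewrite !ltr_nat !ltnS => h1 h2.
by move/eqP: ij; apply; apply/eqP; rewrite eqn_leq h1 h2.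
Qed.

Lemma bigcup_shell A : A = \bigcup_j (A `&` shell j).
Proof.
apply/seteqP; split => [x Ax|x [j _ []]//].
exists (Num.truncn (enorm x)) => //; split => //=.
by rewrite /shell/= truncn_le enorm_ge0 truncnS_gt.
Qed.

Lemma reflection_invariant_of_bounded :
  (forall A (K : R), measurable (A : set (lebRn R n)) -> A `<=` eball 0 K ->
    invariant_set A) -> reflection_invariant.
Proof.
move=> H A mA.
have mAj j : measurable (A `&` shell j : set (lebRn R n)).
  by apply: measurableI => //; exact: measurable_shell.
have Aj j : invariant_set (A `&` shell j).
  apply: (H _ j.+1%:R) => // x [_ /andP[_ /ltW]].
  by rewrite /eball/= subr0.
have tA : trivIset setT (fun j => A `&` shell j).
  by apply: trivIset_setIl; exact: trivIset_shell.
rewrite /invariant_set {1 2 3}(bigcup_shell A) preimage_bigcup; split.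
  by apply: bigcupT_measurable => j; case: (Aj j).
rewrite !measure_bigcup//.
- by apply: eq_eseriesr => j _; case: (Aj j).
- by move=> j _; case: (Aj j).
- apply/trivIsetP => i j _ _ ij; rewrite -preimage_setI.
  by move/trivIsetP: tA => /(_ i j Logic.I Logic.I ij) ->; exact: preimage_set0.
Qed.

Lemma reflection_invariant_dagger :
  (forall f, X f -> T f = dagger v f) -> reflection_invariant.
Proof.
move=> TE; apply: reflection_invariant_of_bounded => A K mA AK.
have Ay : (leb (A : set (lebRn R n)) < +oo)%E.
  by apply: le_lt_trans (leb_eball_lty 0 K); exact: leb_outer_homo.
by apply: T_indic => //; rewrite TE//; exact: indic_in_space.
Qed.

Lemma indic_in (A : set 'rV[R]_n) x : A x -> \1_A x = 1 :> R.
Proof. by move=> xA; rewrite indicE mem_set. Qed.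

Lemma indic_out (A : set 'rV[R]_n) x : ~ A x -> \1_A x = 0 :> R.
Proof. by move=> xA; rewrite indicE memNset. Qed.

(** Polarization carries the indicator of a set on the negative side to that of
   its mirror image. For a set on the positive side it only gives measurability,
   through the complement in a ball centred on H, which loses the mirror image; the
   measure is then found by going back from the negative side. *)
Lemma reflection_invariant_polarization :
  (forall f, X f -> T f = polarization v f) -> reflection_invariant.
Proof.
move=> TE; apply: reflection_invariant_of_bounded => A K mA AK.
have Ky : (leb (eball 0 K : set (lebRn R n)) < +oo)%E by exact: leb_eball_lty.
have mK : measurable (eball 0 K : set (lebRn R n)) by exact: measurable_eball.
have finite (B : set 'rV[R]_n) : B `<=` eball 0 K -> (leb (B : set (lebRn R n)) < +oo)%E.
  by move=> BK; apply: le_lt_trans Ky; exact: leb_outer_homo.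
have Krho x : eball 0 K (rho x) <-> eball 0 K x by rewrite /eball/= !subr0 enorm_reflection.
have neg B : measurable (B : set (lebRn R n)) -> B `<=` eball 0 K ->
    (forall x, B x -> dot x v < 0) -> invariant_set B.
  move=> mB BK Bneg; have By := finite _ BK.
  apply: T_indic => //; rewrite TE; last exact: indic_in_space.
  apply/funext => x; rewrite /polarization; case: (leP 0 (dot x v)) => xv.
    rewrite indic_out; last by move=> /Bneg; rewrite ltNge xv.
    by rewrite max_r// indicE.
  have xB : ~ B (rho x) by move=> /Bneg; rewrite dot_reflection//; lra.
  by rewrite (indic_out xB) (@indic_out (rho @^-1` B) x xB) min_r// indicE.
have pos B : measurable (B : set (lebRn R n)) -> B `<=` eball 0 K ->
    (forall x, B x -> 0 < dot x v) -> invariant_set B.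
  move=> mB BK Bpos.
  have mC : measurable (eball 0 K `\` B : set (lebRn R n)) by exact: measurableD.
  have Cy : (leb (eball 0 K `\` B : set (lebRn R n)) < +oo)%E by apply: finite => x [].
  have [] := @T_indic _ (eball 0 K `\` (rho @^-1` B)) mC Cy.
    rewrite TE; last exact: indic_in_space.
    apply/funext => x; rewrite /polarization.
    have [xK|xK] := pselect (eball 0 K x); last first.
      rewrite !indic_out; try (by move=> [/Krho]); try (by move=> []).
      by rewrite maxxx minxx; case: ifP.
    case: (leP 0 (dot x v)) => xv.
      have xB : ~ B (rho x) by move=> /Bpos; rewrite dot_reflection//; lra.
      rewrite (indic_in (conj _ xB)); last exact/Krho.
      rewrite (@indic_in (eball 0 K `\` rho @^-1` B) x)//; apply: max_r.
      by rewrite indicE; case: (x \in _).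
    have xB : ~ B x by move=> /Bpos; lra.
    rewrite (indic_in (conj xK xB)) min_r; last by rewrite indicE; case: (_ \in _).
    have [rB|rB] := pselect (B (rho x)).
      by rewrite (@indic_out (_ `\` B) (rho x)) ?indic_out// => -[].
    rewrite (@indic_in (_ `\` B) (rho x)) ?indic_in//.
    by split => //; exact/Krho.
  move=> mC' _.
  have mB' : measurable (rho @^-1` B : set (lebRn R n)).
    rewrite (_ : rho @^-1` B = eball 0 K `\` (eball 0 K `\` (rho @^-1` B))).
      exact: measurableD.
    apply/seteqP; split => x /=.
      by move=> xB; split; [exact/Krho/BK|case].
    by move=> [xK] /not_andP[//|/contrapT].
  split => //.
  have [_] : invariant_set (rho @^-1` B).
    apply: neg => // x.
    - by move=> /BK/Krho.
    - by move=> /Bpos; rewrite dot_reflection//; lra.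
  move=> <-; congr leb; apply/seteqP; split => x /=; by rewrite reflectionK.
have mdot (I : interval R) :
    measurable ([set x | dot x v \in I] : set (lebRn R n)).
  rewrite (_ : [set x | _] = [set: lebRn R n] `&`
      (fun x : lebRn R n => dot (x : 'rV[R]_n) v) @^-1` [set` I]).
    by apply: measurable_dot => //; exact: measurable_itv.
  by rewrite setTI.
pose An := A `&` [set x | dot x v \in `]-oo, 0[].
pose Az := A `&` [set x | dot x v \in `[0, 0]].
pose Ap := A `&` [set x | dot x v \in `]0, +oo[].
have mAn : measurable (An : set (lebRn R n)) by exact: measurableI.
have mAz : measurable (Az : set (lebRn R n)) by exact: measurableI.
have mAp : measurable (Ap : set (lebRn R n)) by exact: measurableI.
have invn : invariant_set An.
  by apply: neg => // x [/AK//]; rewrite /= in_itv/=.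
have invp : invariant_set Ap.
  by apply: pos => // x [/AK//]; rewrite /= in_itv/= andbT.
have invz : invariant_set Az.
  suff E : rho @^-1` Az = Az by rewrite /invariant_set E.
  apply/seteqP; split => x [].
    rewrite /Az/= => Ax; rewrite in_itv/= -eq_le dot_reflection// eq_sym oppr_eq0 => /eqP x0.
    rewrite -(reflection_fix x0); split=> //.
    by rewrite in_itv/= reflection_fix// x0 lexx.
  rewrite /Az/= => Ax; rewrite in_itv/= -eq_le eq_sym => /eqP x0.
  by rewrite reflection_fix//; split => //; rewrite in_itv/= x0 lexx.
have AE : A = An `|` (Az `|` Ap).
  apply/seteqP; split => x; last by case=> [[]|[[]|[]]].
  by move=> Ax; case: (ltgtP (dot x v) 0) => x0; [left|right; right|right; left];
    split => //=; rewrite in_itv/= ?x0 ?lexx.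
rewrite AE; apply: invariant_setU => //.
- exact: measurableU.
- apply/seteqP; split => // x [[_ /=]]; rewrite in_itv/= => h [|] [_ /=]; rewrite in_itv/=; lra.
- apply: invariant_setU => //.
  by apply/seteqP; split => // x [[_ /=]]; rewrite in_itv/= => h [_ /=]; rewrite in_itv/=; lra.
Qed.
End reflection_invariance.

(** * Measure preserving maps and rearrangement of two pairs *)

Lemma norm_powR_convex (R : realType) (r l x y : R) : 1 <= r -> 0 <= l -> l <= 1 ->
  `|l * x + (1 - l) * y| `^ r <= l * `|x| `^ r + (1 - l) * `|y| `^ r.
Proof.
move=> r1 l0 l1; have r0 : 0 <= r by apply: le_trans r1.
have l0' : 0 <= 1 - l by rewrite subr_ge0.
apply: (@le_trans _ _ ((l * `|x| + (1 - l) * `|y|) `^ r)).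
  rewrite ge0_ler_powR ?nnegrE ?addr_ge0 ?mulr_ge0//.
  by apply: le_trans (ler_normD _ _) _; rewrite !normrM (ger0_norm l0) (ger0_norm l0').
have /(_ (Itv01 l0 l1) `|x| `|y|) := convex_powR r1.
rewrite !convRE /= !inE/= !in_itv/= !andbT !normr_ge0 => /(_ isT isT).
by rewrite /unstable.onem.
Qed.

(** Replacing the pairing of two pairs of numbers by the monotone pairing can
   only lower the sum of the r-th powers of the distances: the new differences
   lie between the old ones and have the same sum. *)
Lemma powR_dist_rearrangement (R : realType) (r a a' b b' : R) : 1 <= r ->
  `|Num.max a a' - Num.max b b'| `^ r + `|Num.min a a' - Num.min b b'| `^ r <=
  `|a - b| `^ r + `|a' - b'| `^ r.
Proof.
move=> r1.
have core (c c' e e' : R) : c' <= c -> e <= e' ->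
    `|c - e'| `^ r + `|c' - e| `^ r <= `|c - e| `^ r + `|c' - e'| `^ r.
  move=> cc ee; pose s := c - c'; pose t := e' - e.
  have s0 : 0 <= s by rewrite subr_ge0.
  have t0 : 0 <= t by rewrite subr_ge0.
  have [st0|st0] := eqVneq (s + t) 0.
    have -> : c = c' by rewrite /s /t in s0 t0 st0; lra.
    by have -> : e = e' by rewrite /s /t in s0 t0 st0; lra.
  have st : 0 < s + t by rewrite lt_neqAle eq_sym st0 addr_ge0.
  (* c - e' and c' - e are the convex combinations, with exchanged weights, of
     c - e and c' - e' *)
  pose l : R := s / (s + t).
  have l0 : 0 <= l by apply: divr_ge0 => //; exact: ltW.
  have l1 : l <= 1 by rewrite ler_pdivrMr// mul1r lerDl.
  have l0' : 0 <= 1 - l by rewrite subr_ge0.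
  have l1' : 1 - l <= 1 by lra.
  have h1 := norm_powR_convex (c - e) (c' - e') r1 l0 l1.
  have h2 := norm_powR_convex (c - e) (c' - e') r1 l0' l1'.
  have ls : l * (s + t) = s by rewrite /l mulfVK.
  rewrite (_ : l * _ + _ = c - e') in h1; last first.
    by transitivity (l * (s + t) + (c' - e')); [rewrite /s /t|rewrite ls /s]; ring.
  rewrite (_ : (1 - l) * _ + _ = c' - e) in h2; last first.
    transitivity ((s + t) - l * (s + t) + (c' - e')); [rewrite /s /t|rewrite ls /s /t]; ring.
  apply: le_trans (lerD h1 h2) _; lra.
have [aa|aa] := leP a a'; have [bb|bb] := leP b b'.
- by rewrite addrC.
- by have := core a' a b' b aa (ltW bb); rewrite [X in _ <= X]addrC.
- by have := core a a' b b' (ltW aa) bb.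
- by [].
Qed.

Lemma dist_max_le (R : realType) (a a' b b' M : R) :
  `|a - b| <= M -> `|a' - b'| <= M -> `|Num.max a a' - Num.max b b'| <= M.
Proof.
rewrite !ler_norml => /andP[h1 h2] /andP[h3 h4].
by case: (leP a a') => h; case: (leP b b') => h'; apply/andP; split; lra.
Qed.

Lemma dist_min_le (R : realType) (a a' b b' M : R) :
  `|a - b| <= M -> `|a' - b'| <= M -> `|Num.min a a' - Num.min b b'| <= M.
Proof.
rewrite !ler_norml => /andP[h1 h2] /andP[h3 h4].
by case: (leP a a') => h; case: (leP b b') => h'; apply/andP; split; lra.
Qed.

Lemma dist_max_min_le (R : realType) (a a' b b' M : R) :
  `|a - b| <= M -> `|a' - b'| <= M -> `|a - b'| <= M -> `|a' - b| <= M ->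
  `|Num.max a a' - Num.min b b'| <= M.
Proof. by move=> *; case: (leP a a'); case: (leP b b'). Qed.

Section measure_preserving.
Local Open Scope ereal_scope.

Definition measure_preserving d (T : measurableType d) (R : realType)
    (mu : {measure set T -> \bar R}) (phi : T -> T) :=
  measurable_fun setT phi /\ forall A, measurable A -> mu (phi @^-1` A) = mu A.

Lemma measure_preserving_id d (T : measurableType d) (R : realType)
    (mu : {measure set T -> \bar R}) : measure_preserving mu id.
Proof. by split. Qed.

Lemma ae_imply2 d (T : measurableType d) (R : realType)
    (mu : {measure set T -> \bar R}) (P Q S : T -> Prop) :
  (forall x, P x -> Q x -> S x) -> (\forall x \ae mu, P x) ->
  (\forall x \ae mu, Q x) -> \forall x \ae mu, S x.
Proof. by move=> PQS; exact: filterS2. Qed.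

Lemma ae_measure_preserving d (T : measurableType d) (R : realType)
    (mu : {measure set T -> \bar R}) phi (Q : T -> Prop) :
  measure_preserving mu phi -> (\forall x \ae mu, Q x) -> \forall x \ae mu, Q (phi x).
Proof.
move=> [mphi pres] [N [mN N0 QN]]; exists (phi @^-1` N); split.
- by rewrite -[X in measurable X]setTI; exact: mphi.
- by rewrite pres.
- by move=> x Qx; exact: QN.
Qed.

Lemma integral_measure_preserving d (T : measurableType d) (R : realType)
    (mu : {measure set T -> \bar R}) phi (f : T -> \bar R) :
  measure_preserving mu phi -> measurable_fun setT f -> (forall x, 0 <= f x) ->
  \int[mu]_x f (phi x) = \int[mu]_x f x.
Proof.
move=> [mphi pres] mf f0.
have := @ge0_integral_pushforward _ _ _ _ R phi mphi mu setT f measurableT mf (fun y _ => f0 y).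
rewrite preimage_setT => <-; apply: eq_measure_integral => A mA _.
exact: pres.
Qed.

Lemma measure_preserving_prod d1 d2 (T1 : measurableType d1) (T2 : measurableType d2)
    (R : realType) (m1 : {sigma_finite_measure set T1 -> \bar R})
    (m2 : {sigma_finite_measure set T2 -> \bar R}) phi psi :
  measure_preserving m1 phi -> measure_preserving m2 psi ->
  measure_preserving (m1 \x m2) (fun z => (phi z.1, psi z.2)).
Proof.
move=> [mphi pphi] [mpsi ppsi].
have mtheta : measurable_fun setT (fun z : T1 * T2 => (phi z.1, psi z.2)).
  apply: measurable_fun_pair; first exact: measurableT_comp mphi measurable_fst.
  exact: measurableT_comp mpsi measurable_snd.
split => // A mA.
transitivity (pushforward (m1 \x m2) (fun z => (phi z.1, psi z.2)) A) => //.
apply/esym/product_measure_unique => // B C mB mC.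
transitivity ((m1 \x m2) ((phi @^-1` B) `*` (psi @^-1` C))) => //.
rewrite product_measure1E ?pphi ?ppsi//.
- by rewrite -[X in measurable X]setTI; exact: mphi.
- by rewrite -[X in measurable X]setTI; exact: mpsi.
Qed.

(** Averaging over a measure preserving map: it is enough to compare the sums of
   the r-th powers at x and at its image. *)
Lemma Lnorm_le_of_paired d (T : measurableType d) (R : realType)
    (mu : {measure set T -> \bar R}) (phi : T -> T) (p : \bar R) (f g : T -> R) :
  measure_preserving mu phi -> 1 <= p ->
  measurable_fun setT f -> measurable_fun setT g ->
  (forall (r : R) x, (1 <= r)%R ->
    (`|f x| `^ r + `|f (phi x)| `^ r <= `|g x| `^ r + `|g (phi x)| `^ r)%R) ->
  (forall (M : R) x, (`|g x| <= M)%R -> (`|g (phi x)| <= M)%R -> (`|f x| <= M)%R) ->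
  'N[mu]_p[EFin \o f] <= 'N[mu]_p[EFin \o g].
Proof.
move=> pphi p1 mf mg fg_pow fg_max; case: p p1 => [r||//] r1.
  have r0 : (0 < r)%R by rewrite (lt_le_trans ltr01).
  apply: Lnorm_le_of_integral => //.
  have dbl (h : T -> R) : measurable_fun setT h ->
      \int[mu]_x ((`|h x| `^ r)%:E + (`|h (phi x)| `^ r)%:E) =
      2%:E * \int[mu]_x (`|h x| `^ r)%:E.
    move=> mh; have mh' := measurable_norm_powR r mh.
    rewrite ge0_integralD//.
    - rewrite (integral_measure_preserving (f := fun x => (`|h x| `^ r)%:E) pphi)//.
      by rewrite mule_natl mule2n.
    - exact: (measurableT_comp mh' pphi.1).
  rewrite -(@lee_pmul2l _ 2%:E)//.
  rewrite -(dbl f mf) -(dbl g mg).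
  apply: ge0_le_integral => //.
  - by move=> x _; rewrite adde_ge0// lee_fin powR_ge0.
  - apply: emeasurable_funD; first exact: measurable_norm_powR.
    exact: (measurableT_comp (measurable_norm_powR r mf) pphi.1).
  - apply: emeasurable_funD; first exact: measurable_norm_powR.
    exact: (measurableT_comp (measurable_norm_powR r mg) pphi.1).
  - by move=> x _; rewrite -!EFinD lee_fin; exact: fg_pow.
rewrite unlock; case: ifPn => // _; set M := ess_sup mu (abse \o (EFin \o g)).
apply/ess_supP.
have h1 : \forall x \ae mu, (abse \o (EFin \o g)) x <= M by exact: ess_sup_ge.
have h2 := ae_measure_preserving pphi h1.
apply: ae_imply2 h1 h2 => x /=.
by case: M => [M||]//; rewrite ?leey// !lee_fin; exact: fg_max.
Qed.
End measure_preserving.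

(** * Properties of the reflection and of polarization *)

Section continuity_of_maps.
Context (R : realType) (n : nat) (v : 'rV[R]_n) (v1 : enorm v = 1).
Implicit Types (f : 'rV[R]_n -> R) (x y : 'rV[R]_n).

Lemma polarizationN f : polarization (- v) f = dagger v (polarization v f).
Proof.
apply/funext => x; rewrite /dagger /polarization dotNr reflectionN//.
rewrite dot_reflection// reflectionK//; case: ifP => _; [exact: maxC|exact: minC].
Qed.

Lemma enorm_continuity x (e : R) : 0 < e ->
  exists2 d : R, 0 < d & forall y, ball x d y -> enorm (x - y) < e.
Proof.
move=> e0; pose d := e / n.+1%:R.
have d0 : 0 < d by rewrite divr_gt0.
exists d => // y [_ xy].
suff h : dot (x - y) (x - y) < e ^+ 2.
  by rewrite -(@ltr_pXn2r _ 2)// ?nnegrE ?enorm_ge0 ?ltW// sqr_enorm.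
apply: (@le_lt_trans _ _ (\sum_(i < n) d ^+ 2)).
  apply: ler_sum => i _; rewrite -expr2 -real_normK ?num_real//.
  have := xy ord0 i; rewrite /ball/= => h; rewrite !mxE.
  by rewrite ler_pXn2r ?nnegrE// ltW.
rewrite sumr_const card_ord -mulr_natl /d exprMn mulrCA gtr_pMr ?exprn_gt0//.
rewrite exprVn ltr_pdivrMr ?exprn_gt0// mul1r -natrX ltr_nat.
by rewrite expnS expn1 (leq_trans (ltnSn n))// leq_pmulr.
Qed.

Lemma continuousP_enorm f : continuous f <-> forall x (e : R), 0 < e ->
  exists2 d : R, 0 < d & forall y, enorm (x - y) < d -> `|f x - f y| < e.
Proof.
split=> [cf x e e0|H x].
  have /cvgrPdist_lt /(_ e e0) /nbhs_ballP[d /= d0 sub] := cf x.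
  exists d => // y xy; apply: sub; split => // i j.
  rewrite ord1 /ball/=; apply: le_lt_trans xy.
  by have := norm_coord_le (x - y) j; rewrite !mxE.
apply/(@cvgrPdist_lt _ _ _ (nbhs x) (nbhs_filter x)) => e e0.
have [d d0 sub] := H x e e0.
have [d' d'0 sub'] := enorm_continuity x d0.
by apply/nbhs_ballP; exists d' => //= y /sub'; exact: sub.
Qed.

Lemma continuous_dagger f : continuous f -> continuous (dagger v f).
Proof.
move=> /continuousP_enorm cf; apply/continuousP_enorm => x e e0.
have [d d0 sub] := cf (reflection v x) e e0; exists d => // y xy.
by apply: sub; rewrite -reflectionB// enorm_reflection.
Qed.

(** Reflecting x alone adds 4 (x . v) (y . v) to the squared distance. *)
Lemma enorm_opposite x y : 0 <= dot x v -> dot y v <= 0 ->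
  enorm (reflection v x - y) <= enorm (x - y).
Proof.
move=> x0 y0; rewrite enorm_le ?enorm_ge0// sqr_enorm.
have zv : dot (x - y) v = dot x v - dot y v by rewrite dotBl.
rewrite (_ : reflection v x - y = (x - y) - (2 * dot x v) *: v); last exact: addrAC.
move: (x - y) zv => z zv; rewrite !(dotBl, dotBr, dotZl, dotZr) (dotC v z) zv (dot_unit v1).
have := mulr_ge0_le0 x0 y0; lra.
Qed.

(** The values of polarization at two points on the same side are compared with
   the parallel pairings of the points and their images. On opposite sides the
   crossed pairings enter as well, and there they are not longer. *)
Lemma polarization_dist f x y (d M : R) : enorm (x - y) <= d ->
  (forall x' y', x' = x \/ x' = reflection v x -> y' = y \/ y' = reflection v y ->
     enorm (x' - y') <= d -> `|f x' - f y'| <= M) ->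
  `|polarization v f x - polarization v f y| <= M.
Proof.
move=> xyd H.
have rr : enorm (reflection v x - reflection v y) <= d.
  by rewrite -reflectionB// enorm_reflection.
have h1 : `|f x - f y| <= M by apply: H; [left|left|].
have h2 : `|f (reflection v x) - f (reflection v y)| <= M by apply: H; [right|right|].
rewrite /polarization; have [x0|x0] := leP 0 (dot x v); have [y0|y0] := leP 0 (dot y v).
- exact: dist_max_le.
- have cross : enorm (reflection v x - y) <= d.
    by apply: le_trans xyd; apply: enorm_opposite => //; exact: ltW.
  apply: dist_max_min_le => //; last by apply: H; [right|left|].
  by apply: H; [left|right|rewrite -enorm_reflectionB].
- have cross : enorm (reflection v y - x) <= d.
    by rewrite enormBC in xyd; apply: le_trans xyd; apply: enorm_opposite => //; exact: ltW.
  rewrite distrC; apply: dist_max_min_le => //.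
  + by rewrite distrC.
  + by rewrite distrC.
  + by rewrite distrC; apply: H; [right|left|rewrite enorm_reflectionB// enormBC].
  + by rewrite distrC; apply: H; [left|right|rewrite enormBC].
- exact: dist_min_le.
Qed.

Lemma continuous_polarization f : continuous f -> continuous (polarization v f).
Proof.
move=> /continuousP_enorm cf; apply/continuousP_enorm => x e e0.
have e20 : 0 < e / 2 by rewrite divr_gt0.
have [d d0 sub] := cf x _ e20; have [d' d'0 sub'] := cf (reflection v x) _ e20.
exists (Num.min d d'); first by rewrite lt_min d0.
move=> y; rewrite lt_min => /andP[xy xy'].
apply: (@le_lt_trans _ _ (e / 2)); last by lra.
pose r := enorm (x - y).
apply: (@polarization_dist f x y r) => // x' y' [->|->] _ h; apply/ltW.
  by apply: sub; apply: le_lt_trans h _.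
by apply: sub'; apply: le_lt_trans h _.
Qed.
End continuity_of_maps.

Section consequences.
Context (R : realType) (n : nat) (v : 'rV[R]_n) (v1 : enorm v = 1).
Context (inv : reflection_invariant v).
Implicit Types (f g h : 'rV[R]_n -> R).

Lemma measure_preserving_reflection :
  measure_preserving (@leb R n) (reflection v : lebRn R n -> lebRn R n).
Proof.
split=> [_ Y mY|Y mY]; last by case: (inv mY).
by rewrite setTI; case: (inv mY).
Qed.

Lemma ae_le_dagger f g : (\forall x \ae (@leb R n), f x <= g x) ->
  \forall x \ae (@leb R n), dagger v f x <= dagger v g x.
Proof. exact: (ae_measure_preserving measure_preserving_reflection). Qed.

Lemma ae_le_polarization f g : (\forall x \ae (@leb R n), f x <= g x) ->
  \forall x \ae (@leb R n), polarization v f x <= polarization v g x.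
Proof.
move=> fg; apply: ae_imply2 fg (ae_le_dagger fg) => x fg fg'.
rewrite /polarization; case: ifP => _; first by rewrite ge_max !le_max fg fg' orbT.
by rewrite le_min !ge_min fg fg' orbT.
Qed.

Lemma Lnorm_dagger_le (p : \bar R) h g : (1 <= p)%E ->
  measurable_fun setT ((dagger v h \- dagger v g) : lebRn R n -> R) ->
  measurable_fun setT ((h \- g) : lebRn R n -> R) ->
  ('N[@leb R n]_p[EFin \o (dagger v h \- dagger v g)%R] <=
   'N[@leb R n]_p[EFin \o (h \- g)%R])%E.
Proof.
move=> p1 m1 m2.
apply: (Lnorm_le_of_paired measure_preserving_reflection p1 m1 m2) => [r x r1|M x].
  by rewrite /dagger /= reflectionK// addrC.
by [].
Qed.

Lemma Lnorm_polarization_le (p : \bar R) h g : (1 <= p)%E ->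
  measurable_fun setT ((polarization v h \- polarization v g) : lebRn R n -> R) ->
  measurable_fun setT ((h \- g) : lebRn R n -> R) ->
  ('N[@leb R n]_p[EFin \o (polarization v h \- polarization v g)%R] <=
   'N[@leb R n]_p[EFin \o (h \- g)%R])%E.
Proof.
move=> p1 m1 m2.
apply: (Lnorm_le_of_paired measure_preserving_reflection p1 m1 m2) => [r x r1|M x].
  rewrite /polarization /= reflectionK// dot_reflection// oppr_ge0.
  have := powR_dist_rearrangement (h x) (h (reflection v x)) (g x) (g (reflection v x)) r1.
  case: (ltgtP (dot x v) 0) => x0.
  - by rewrite addrC maxC [Num.max (g _) (g _)]maxC.
  - by rewrite [Num.min (h (_ _ _)) _]minC [Num.min (g (_ _ _)) _]minC.
  - by rewrite reflection_fix// !maxxx.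
rewrite /= /polarization; case: ifP => _; [exact: dist_max_le|exact: dist_min_le].
Qed.

(** A property of almost all pairs of points survives when either point is replaced
   by its mirror image, since the product measure is preserved. *)
Lemma modulus_of_continuity_le (d : R) f h :
  (forall x y (M : R), enorm (x - y) <= d ->
    (forall x' y', x' = x \/ x' = reflection v x -> y' = y \/ y' = reflection v y ->
       enorm (x' - y') <= d -> `|f x' - f y'| <= M) -> `|h x - h y| <= M) ->
  (modulus_of_continuity d h <= modulus_of_continuity d f)%E.
Proof.
move=> H; apply/ereal_inf_le_tmp => c /= fc.
have mp := measure_preserving_reflection; have mi := measure_preserving_id (@leb R n).
have f11 := ae_measure_preserving (measure_preserving_prod mi mi) fc.
have f12 := ae_measure_preserving (measure_preserving_prod mi mp) fc.
have f21 := ae_measure_preserving (measure_preserving_prod mp mi) fc.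
have f22 := ae_measure_preserving (measure_preserving_prod mp mp) fc.
apply: (ae_imply2 _ (ae_imply2 (fun _ => @conj _ _) f11 f12)
  (ae_imply2 (fun _ => @conj _ _) f21 f22)) => -[x y] /= [g11 g12] [g21 g22] xyd.
move: c g11 g12 g21 g22 {fc f11 f12 f21 f22} => [c||] g11 g12 g21 g22.
- rewrite lee_fin; apply: (H x y c xyd) => x' y' [->|->] [->|->] h'; rewrite -lee_fin.
  + exact: g11.
  + exact: g12.
  + exact: g21.
  + exact: g22.
- by rewrite leey.
- by have := g11 xyd.
Qed.
End consequences.

(** * The equivalence *)

Section four_maps_properties.
Context (R : realType) (n : nat) (u : 'rV[R]_n) (u1 : enorm u = 1).
Context (k : space_kind) (T : ('rV[R]_n -> R) -> 'rV[R]_n -> R).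
Local Notation X := (@function_space R n k).
Context (TX : forall f, X f -> X (T f)) (T_equimeasurable : equimeasurable X T).
Context (fm : four_maps u k T).

(** Unless T is the identity, T itself transports measures of sets across H, so
   that the invariance of Lebesgue measure under the reflection is inherited
   from the equimeasurability of T. The reversed polarization is the
   polarization for the opposite orientation. *)
Lemma identity_or_reflection_invariant :
  [\/ forall f, X f -> T f = f,
      reflection_invariant u /\ forall f, X f -> T f = dagger u f |
      exists v, [/\ enorm v = 1, reflection_invariant v &
        forall f, X f -> T f = polarization v f]].
Proof.
case: fm => TE.
- exact: Or31.
- by apply: Or32; split => //; exact: reflection_invariant_dagger TX T_equimeasurable TE.
- apply: Or33; exists u; split => //.
  exact: reflection_invariant_polarization TX T_equimeasurable TE.
- have TE' f : X f -> T f = polarization (- u) f by move=> /TE ->; rewrite polarizationN.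
  have u1' : enorm (- u) = 1 by rewrite enormN.
  apply: Or33; exists (- u); split => //.
  exact: reflection_invariant_polarization TX T_equimeasurable TE'.
Qed.

Lemma four_maps_monotonic : monotonic X T.
Proof.
move=> f g Xf Xg fg.
have [TE|[inv TE]|[v [v1 inv TE]]] := identity_or_reflection_invariant.
- by rewrite !TE.
- by rewrite !TE//; exact: ae_le_dagger.
- by rewrite !TE//; exact: ae_le_polarization.
Qed.

Lemma four_maps_continuous_on_tests f : test_function k f -> continuous (T f).
Proof.
move=> tf; have Xf := test_function_in_space tf.
have cf := continuous_test_function tf.
have [TE|[inv TE]|[v [v1 inv TE]]] := identity_or_reflection_invariant.
- by rewrite TE.
- by rewrite TE//; exact: continuous_dagger.
- by rewrite TE//; exact: continuous_polarization.
Qed.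

Lemma four_maps_Lp_contracting (p : \bar R) : (1 <= p)%E -> Lp_contracting X p T.
Proof.
move=> p1 f g Xf Xg _.
have mB (f' g' : 'rV[R]_n -> R) : X f' -> X g' ->
    measurable_fun setT ((f' \- g')%R : lebRn R n -> R).
  by move=> Xf' Xg'; apply: measurable_funB; exact: (@measurable_of_space _ _ k).
have mfg := mB _ _ Xf Xg; have := mB _ _ (TX Xf) (TX Xg).
have [TE|[inv TE]|[v [v1 inv TE]]] := identity_or_reflection_invariant.
- by rewrite !TE.
- by rewrite !TE// => mT; exact: Lnorm_dagger_le.
- by rewrite !TE// => mT; exact: Lnorm_polarization_le.
Qed.

Lemma four_maps_reduces_modulus : reduces_modulus_of_continuity X T.
Proof.
move=> f Xf d d0.
have [TE|[inv TE]|[v [v1 inv TE]]] := identity_or_reflection_invariant.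
- by rewrite TE.
- rewrite TE//; apply: (modulus_of_continuity_le inv) => x y M xyd H.
  by apply: H; [right|right|rewrite -reflectionB// enorm_reflection].
- rewrite TE//; apply: (modulus_of_continuity_le inv) => x y M xyd H.
  exact: polarization_dist xyd H.
Qed.
End four_maps_properties.

Lemma unit_vector_in_hyperplane (R : realType) (n : nat) (H : {vspace 'rV[R]_n})
    (u : 'rV[R]_n) : (2 <= n)%N -> oriented_hyperplane H u ->
  exists w, dot w u = 0 /\ dot w w = 1.
Proof.
move=> n2 [dimH _ Hu]; pose w := vpick H.
have w0 : w != 0.
  rewrite vpick0; apply: contraTneq n2 => H0.
  by move: dimH; rewrite H0 dimv0; case: (n) => [|[]].
have e0 : enorm w != 0.
  apply: contraNneq w0 => e0; apply/eqP/dotxx_eq0.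
  by rewrite -sqr_enorm e0 expr0n.
exists ((enorm w)^-1 *: w); split.
  by rewrite dotZl Hu ?mulr0// memv_pick.
by rewrite dotZl dotZr -sqr_enorm expr2 (mulrA _^-1 (enorm w)) mulVf // mul1r mulVf.
Qed.

Theorem theorem5p8 (R : realType) (n : nat) (n_ge2 : (2 <= n)%N)
    (H : {vspace 'rV[R]_n}) (u : 'rV[R]_n) (orientH : oriented_hyperplane H u)
    (k : space_kind) (X : set ('rV[R]_n -> R)) (XE : X = function_space k)
    (T : ('rV[R]_n -> R) -> 'rV[R]_n -> R) (TX : forall f, X f -> X (T f))
    (Fplus Fminus : R * R -> R)
    (T_pointwise : pointwise_map X u T Fplus Fminus)
    (T_equimeasurable : equimeasurable X T) :
  [<->
    (* (i) *)
    {within value_set X `*` value_set X, continuous Fplus} /\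
    {within value_set X `*` value_set X, continuous Fminus};
    (* (ii) *)
    monotonic X T;
    (* (iii) *)
    rearrangement X T;
    (* (iv) *)
    forall f, test_function k f -> continuous (T f);
    (* (v), for some p *)
    exists2 p : \bar R, (1 <= p)%E & Lp_contracting X p T;
    (* (v), for all p *)
    forall p : \bar R, (1 <= p)%E -> Lp_contracting X p T;
    (* (vi) *)
    reduces_modulus_of_continuity X T;
    (* (vii) *)
    [\/ forall f, X f -> T f = f,
        forall f, X f -> T f = dagger u f,
        forall f, X f -> T f = polarization u f |
        forall f, X f -> T f = dagger u (polarization u f)]].
Proof.
have [_ u1 _] := orientH.
have [w [wu ww]] := unit_vector_in_hyperplane n_ge2 orientH.
subst X; rewrite (value_setE u1 k).
have of_constant := four_maps_of_constant_choice u1 T_pointwise T_equimeasurable.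
have of_local lc := of_constant (constant_choice_of_local lc).
have of_tests := continuous_on_tests_locally_constant_choice u1 T_pointwise T_equimeasurable wu ww.
have of_Lp p (p1 : (1 <= p)%E) :=
  Lp_contracting_locally_constant_choice u1 T_pointwise T_equimeasurable p1 TX.
tfae.
- case=> /(continuous_locally_constant_choice u1 T_pointwise T_equimeasurable)/of_local fm _.
  exact: (four_maps_monotonic u1 TX T_equimeasurable fm).
- by split.
- case=> _ /(monotonic_constant_choice u1 T_pointwise T_equimeasurable)/of_constant fm.
  exact: (four_maps_continuous_on_tests u1 TX T_equimeasurable fm).
- move=> /of_tests/of_local fm; exists 1%E => //.
  exact: (four_maps_Lp_contracting u1 TX T_equimeasurable fm).
- move=> [p p1 /(of_Lp p p1)/of_local fm] q q1.
  exact: (four_maps_Lp_contracting u1 TX T_equimeasurable fm).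
- move=> /(_ 1%E (lexx _))/(of_Lp _ (lexx _))/of_local fm.
  exact: (four_maps_reduces_modulus u1 TX T_equimeasurable fm).
- by move=> /(reduces_modulus_locally_constant_choice u1 T_pointwise T_equimeasurable)/of_local.
- exact: (four_maps_continuous u1 T_pointwise T_equimeasurable).
Qed.
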